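(* Let $H$ be a complex Hilbert space and let $\lambda\in[0,1]$. For every $T\in\mathcal{B}(H)$ and each natural number $n$, the following limit exists and $$r(T)=\lim_{k\to\infty}w(\Delta_\lambda^n(T^k))^{1/k}.$$
   Context: $H$ is a (nonzero) complex Hilbert space, $\mathcal{B}(H)$ is the space of bounded linear operators on $H$, and $r(T)$ is the spectral radius of $T$. The numerical range of $T$ is $W(T)=\{\langle Tx,x\rangle : \|x\|=1\}$ and its numerical radius is $w(T)=\sup\{|\mu| : \mu\in W(T)\}$. For $T\in\mathcal{B}(H)$, $|T|=(T^*T)^{1/2}$ and $T=U|T|$ is the unique polar decomposition, with $U$ the partial isometry satisfying $\ker U=\ker T$. For $\lambda\in[0,1]$ the $\lambda$-Aluthge transform is $\Delta_\lambda(T)=|T|^{\lambda}U|T|^{1-\lambda}$, with the convention $|T|^0=I$, so that $\Delta_0(T)=U|T|=T$ and $\Delta_1(T)=|T|U$. Its iterates are $\Delta_\lambda^0(T)=T$ and $\Delta_\lambda^{n+1}(T)=\Delta_\lambda(\Delta_\lambda^n(T))$. Natural numbers include $0$. *)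

(* Defs.v *)
From HB Require Import structures.
From mathcomp Require Import all_boot all_order all_algebra.
From mathcomp Require Import sesquilinear complex.
From mathcomp Require Import all_classical all_reals all_analysis.

Set Implicit Arguments.
Unset Strict Implicit.
Unset Printing Implicit Defensive.

Import Order.TTheory GRing.Theory Num.Theory Num.Def.
Import numFieldNormedType.Exports.

Local Open Scope classical_set_scope.
Local Open Scope ring_scope.
Local Open Scope complex_scope.

(* Operators on H are plain functions H -> H, those of B(H) being singled out
   by bounded_op.  Norms of vectors and moduli of complex numbers live in R[i];
   complex.Re brings them back to R when a real supremum is taken. *)
Section Operators.
Variables (R : realType) (H : completeNormedModType R[i]).
Implicit Types (A B S T U : H -> H).

Definition bounded_op T : Prop :=
  linear T /\ exists M : R[i], forall x, `|T x| <= M * `|x|.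

Definition op_norm T : R := sup [set complex.Re `|T x| | x in [set x | `|x| <= 1]].

Definition spectrum T : set R[i] :=
  [set mu | ~ exists S, [/\ bounded_op S,
                            forall x, S (T x - mu *: x) = x &
                            forall x, T (S x) - mu *: S x = x]].

Definition spectral_radius T : R := sup [set complex.Re `|mu| | mu in spectrum T].

Definition op_poly (p : {poly R}) T : H -> H :=
  fun x => \sum_(i < size p) (p`_i)%:C *: iter i T x.

(* Continuous functional calculus f(A), for a self-adjoint A (whose spectrum is
   therefore real) and f continuous on the spectrum of A: the norm limit of
   p_n(A) for any real polynomials p_n converging to f uniformly on the
   spectrum. *)
Definition is_func_calc (f : R -> R) A B : Prop :=
  bounded_op B /\
  exists p : nat -> {poly R},
    (forall e : R, 0 < e ->
       \forall n \near \oo,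
         forall t : R, spectrum A t%:C -> `|(p n).[t] - f t| <= e) /\
    op_norm (fun x => op_poly (p n) A x - B x) @[n --> \oo] --> (0 : R).

Definition func_calc (f : R -> R) A : H -> H := get (is_func_calc f A).

(* A ^ s for A positive and s >= 0. Since a `^ 0 = 1 for every a, including
   a = 0, the convention A ^ 0 = I is built in. *)
Definition op_powR A (s : R) : H -> H := func_calc (fun t => t `^ s) A.

Section InnerProduct.
(* Linear in the first argument, conjugate-linear in the second. *)
Variable dot : {dot H for conjC}.

Definition adjoint T : H -> H :=
  get [set S | bounded_op S /\ forall x y, dot (T x) y = dot x (S y)].

Definition op_abs T : H -> H := op_powR (adjoint T \o T) 2^-1.

Definition ker T : set H := [set x | T x = 0].

Definition partial_isometry U : Prop :=
  bounded_op U /\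
  forall x, (forall y, ker U y -> dot x y = 0) -> `|U x| = `|x|.

Definition polar T : H -> H :=
  get [set U | [/\ partial_isometry U, ker U = ker T & T = U \o op_abs T]].

Definition aluthge (lambda : R) T : H -> H :=
  op_powR (op_abs T) lambda \o polar T \o op_powR (op_abs T) (1 - lambda).

Definition numerical_range T : set R[i] :=
  [set dot (T x) x | x in [set x | `|x| = 1]].

Definition numerical_radius T : R :=
  sup [set complex.Re `|mu| | mu in numerical_range T].

End InnerProduct.
End Operators.

(* Main.v *)
(* For every nonzero mu in the spectrum of T, mu ^ k lies in the spectrum of T^k
   and, since AB and BA have the same nonzero spectrum, in that of each of its
   iterated Aluthge transforms; as the spectrum of an operator lies in the disc
   of radius its numerical radius, r(T)^k <= w(Delta^n(T^k)).  Conversely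
   w(Delta^n(T^k)) <= ||Delta^n(T^k)|| <= ||T^k||, because |T|^lambda and
   |T|^(1 - lambda) have norms at most ||T||^lambda and ||T||^(1 - lambda).
   Gelfand's formula closes the squeeze.  It is proved without holomorphic
   functions: averaging (1 - w^j t T)^-1 over the n-th roots of unity w^j gives
   (1 - t^n T^n)^-1, and a uniform bound on the resolvent over the disc
   |a| <= 1/s lets one increase, in steps of fixed size, the t for which
   t^n T^n tends to 0. *)
Require Import Defs.
From mathcomp Require Import all_boot all_order all_algebra.
From mathcomp Require Import sesquilinear complex cyclic separable cyclotomic.
From mathcomp Require Import all_classical all_reals all_analysis.
From mathcomp Require Import ring lra.
Import Order.TTheory GRing.Theory Num.Theory Num.Def.
Import numFieldNormedType.Exports.
Local Open Scope classical_set_scope.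
Local Open Scope ring_scope.
Local Open Scope complex_scope.

Set Implicit Arguments.
Unset Strict Implicit.
Unset Printing Implicit Defensive.

(** * Real-valued norms *)

(** [adjoint], [func_calc] and [polar] are chosen by [get], so nothing is known about them until an
    operator with the defining property is exhibited; much of the work is that existence. For the
    powers of |T| it rests on the bound ||p(A)|| <= sup |p| over the spectrum, for A self-adjoint
    and p real. With c the norm of p(A), p(A)^2 - c^2 cannot be inverted, and splitting p^2 - c^2
    into complex linear factors yields a point of the spectrum where |p| = c; this also shows that
    such a spectrum is not empty. Identities between functions on the spectrum pass to operators by
    uniqueness. One criterion locates spectra everywhere: B is invertible as soon as |<Bx,x>| >= c
    |x|^2 with c > 0. It gives reality, positivity, and the discs of radius ||T|| and w(T).
    Exchanging the factors of a product can lose 0 from the spectrum; this is harmless, since 0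
    never exceeds the radius to be bounded below. In the disc argument one constant bounds all the
    resolvents on a compact disc, which is why the steps have a fixed size and finitely many
    suffice. *)

Section RealNorm.
Variables (R : realType) (V : normedZmodType R[i]).
Implicit Types x y z : V.

(** Norms over R[i] are compared in a partial order; the real part moves every estimate to the total
    order of R. *)
Definition nrm x : R := complex.Re `|x|.

Lemma nrmE x : `|x| = (nrm x)%:C.
Proof. by rewrite /nrm RRe_real ?normr_real. Qed.

Lemma nrm_ge0 x : 0 <= nrm x.
Proof. by rewrite -ler0c -nrmE. Qed.

Lemma nrm0 : nrm 0 = 0.
Proof. by rewrite /nrm normr0. Qed.

Lemma nrm_eq0 x : (nrm x == 0) = (x == 0).
Proof. by rewrite -(inj_eq (@complexI R)) -nrmE normr_eq0. Qed.

Lemma nrm_le0 x : nrm x <= 0 -> x = 0.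
Proof. by move=> h; apply/eqP; rewrite -nrm_eq0 eq_le h nrm_ge0. Qed.

Lemma nrmN x : nrm (- x) = nrm x.
Proof. by rewrite /nrm normrN. Qed.

Lemma nrmBC x y : nrm (x - y) = nrm (y - x).
Proof. by rewrite -nrmN opprB. Qed.

Lemma nrmD x y : nrm (x + y) <= nrm x + nrm y.
Proof. by rewrite -lecR rmorphD /= -!nrmE ler_normD. Qed.

Lemma nrmB x y : nrm (x - y) <= nrm x + nrm y.
Proof. by rewrite -(nrmN y) nrmD. Qed.

Lemma nrm_dist_le x y z : nrm (x - z) <= nrm (x - y) + nrm (y - z).
Proof.
have -> : x - z = (x - y) + (y - z) by rewrite addrA subrK.
exact: nrmD.
Qed.

Lemma nrm_sub_ge x y : nrm x - nrm y <= nrm (x - y).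
Proof. by rewrite lerBlDr -{1}(subrK y x) nrmD. Qed.

Lemma nrm_eps0 x : (forall e : R, 0 < e -> nrm x <= e) -> x = 0.
Proof.
by move=> h; apply: nrm_le0; apply/ler_addgt0Pr => e e0; rewrite add0r h.
Qed.

Lemma nrm_sum (I : Type) (r : seq I) (P : pred I) (F : I -> V) :
  nrm (\sum_(i <- r | P i) F i) <= \sum_(i <- r | P i) nrm (F i).
Proof.
elim/big_ind2: _ => // [|x a y b xa yb]; first by rewrite nrm0.
by rewrite (le_trans (nrmD _ _)) // lerD.
Qed.

End RealNorm.

Section ComplexNrm.
Variable R : realType.
Implicit Types (a b : R[i]) (t : R).

Lemma nrmM a b : nrm (a * b) = nrm a * nrm b.
Proof. by apply: (@complexI R); rewrite rmorphM /= -!nrmE normrM. Qed.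

Lemma nrm1 : nrm (1 : R[i]) = 1.
Proof. by rewrite /nrm normr1. Qed.

Lemma nrmX a n : nrm (a ^+ n) = nrm a ^+ n.
Proof. by elim: n => [|n IH]; rewrite ?expr0 ?nrm1 // !exprS nrmM IH. Qed.

Lemma nrmV a : nrm a^-1 = (nrm a)^-1.
Proof. by apply: (@complexI R); rewrite fmorphV /= -!nrmE normfV. Qed.

Lemma nrmC t : nrm t%:C = `|t|.
Proof. by rewrite /nrm normc_def /= expr0n addr0 sqrtr_sqr. Qed.

Lemma nrm_conj a : nrm a^*%R = nrm a.
Proof. by rewrite /nrm norm_conjC. Qed.

Lemma Re_le_nrm a : `|complex.Re a| <= nrm a.
Proof.
rewrite /nrm normc_def /= -[leLHS]sqrtr_sqr ler_wsqrtr // lerDl sqr_ge0 //.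
Qed.

Lemma Im_le_nrm a : `|complex.Im a| <= nrm a.
Proof.
rewrite /nrm normc_def /= -[leLHS]sqrtr_sqr ler_wsqrtr // lerDr sqr_ge0 //.
Qed.

Lemma nrm_le_ReIm a : nrm a <= `|complex.Re a| + `|complex.Im a|.
Proof.
rewrite {1}(complexE a) (le_trans (nrmD _ _)) // nrmM !nrmC.
by rewrite lerD // /nrm normc_def /= expr0n /= add0r expr1n sqrtr1 mul1r.
Qed.

End ComplexNrm.

Section NormedModule.
Variables (R : realType) (V : normedModType R[i]).

Lemma nrmZ (a : R[i]) (x : V) : nrm (a *: x) = nrm a * nrm x.
Proof. by apply: (@complexI R); rewrite rmorphM /= -!nrmE normrZ. Qed.

Lemma nrmZC (t : R) (x : V) : nrm (t%:C *: x) = `|t| * nrm x.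
Proof. by rewrite nrmZ nrmC. Qed.

End NormedModule.

Section Completeness.
Variables (R : realType) (H : completeNormedModType R[i]).

Definition tends (u : nat -> H) (l : H) :=
  forall e : R, 0 < e -> exists N, forall n, (N <= n)%N -> nrm (u n - l) <= e.

Lemma nrm_cauchy_tends (u : nat -> H) :
  (forall e : R, 0 < e ->
     exists N, forall m n, (N <= m)%N -> (N <= n)%N -> nrm (u m - u n) <= e) ->
  exists l, tends u l.
Proof.
move=> hc.
have cu : cvgn u.
  apply/cauchy_cvgP/cauchy_ballP => e e0; near_simpl.
  have e0' : 0 < complex.Re e / 2.
    by rewrite divr_gt0 //; move: e0; rewrite ltcE /= => /andP[].
  have [N hN] := hc _ e0'.
  exists ([set n | (N <= n)%N], [set n | (N <= n)%N]).
    by split; exists N.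
  move=> [m n] [/= hm hn]; rewrite -ball_normE /=.
  (* In the order of R[i], a positive number is real. *)
  have -> : e = (complex.Re e)%:C.
    by rewrite RRe_real // ger0_real // ltW.
  rewrite nrmE ltcR; apply: (le_lt_trans (hN _ _ hm hn)).
  by rewrite ltr_pdivrMr //; lra.
have /cvg_ballP hl := cu.
exists (limn u) => e e0.
have e0' : 0 < e%:C by rewrite ltcR.
have [N _ hN] := hl _ e0'.
exists N => n hn; have := hN n hn.
by rewrite -ball_normE /= nrmE ltcR nrmBC => /ltW.
Unshelve. all: by end_near.
Qed.

Lemma tends_unique (u : nat -> H) l l' : tends u l -> tends u l' -> l = l'.
Proof.
move=> h h'; apply/eqP; rewrite -subr_eq0; apply/eqP/nrm_eps0 => e e0.
have e2 : 0 < e / 2 by rewrite divr_gt0.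
have [N hN] := h _ e2; have [N' hN'] := h' _ e2.
have := hN (maxn N N') (leq_maxl _ _); have := hN' (maxn N N') (leq_maxr _ _).
have := nrm_dist_le l (u (maxn N N')) l'; rewrite (nrmBC l (u _)).
lra.
Qed.

End Completeness.

(** * Bounded operators on a Hilbert space *)

(** Dividing by [K + 1] covers [K = 0]. It fixes in advance a tolerance that survives multiplication
    by a known bound. *)
Lemma small_factor (R : realType) (e K : R) : 0 < e -> 0 <= K ->
  exists d : R, 0 < d /\ d * K <= e.
Proof.
move=> e0 K0; have K1 : 0 < K + 1 by rewrite ltr_wpDl.
exists (e / (K + 1)); split; first exact: divr_gt0.
by rewrite mulrAC ler_pdivrMr // ler_wpM2l ?lerDl // ltW.
Qed.

Lemma le_add_eps (R : realType) (x y : R) :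
  (forall e : R, 0 < e -> x <= y + e) -> x <= y.
Proof. by move=> h; apply/ler_addgt0Pr. Qed.

Lemma invSn_le (R : realType) (e : R) : 0 < e ->
  exists N, forall n, (N <= n)%N -> n.+1%:R^-1 <= e.
Proof.
move=> e0; have [N _ hN] := near_infty_natSinv_lt (PosNum e0).
by exists N => n hn; apply/ltW; exact: hN.
Qed.

Section Operators.
Variables (R : realType) (H : completeNormedModType R[i]).
Implicit Types (x y z : H) (A B S T : H -> H) (M : R).

Lemma lin0 T : linear T -> T 0 = 0.
Proof.
move=> l; have h := l 1 0 0; rewrite !scaler0 !addr0 scale1r in h.
by apply: (@addrI _ (T 0)); rewrite -h addr0.
Qed.

Lemma linD T x y : linear T -> T (x + y) = T x + T y.
Proof. by move=> l; have := l 1 x y; rewrite !scale1r. Qed.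

Lemma linZ T a x : linear T -> T (a *: x) = a *: T x.
Proof. by move=> l; have := l a x 0; rewrite (lin0 l) !addr0. Qed.

Lemma linN T x : linear T -> T (- x) = - T x.
Proof. by move=> l; rewrite -scaleN1r linZ // scaleN1r. Qed.

Lemma linB T x y : linear T -> T (x - y) = T x - T y.
Proof. by move=> l; rewrite linD // linN. Qed.

Lemma lin_sum T (I : Type) (r : seq I) (P : pred I) (F : I -> H) : linear T ->
  T (\sum_(i <- r | P i) F i) = \sum_(i <- r | P i) T (F i).
Proof.
move=> l; elim/big_rec2: _ => [|i y x _ <-]; first exact: lin0.
by rewrite linD.
Qed.

Lemma lin_id : linear (id : H -> H).
Proof. by []. Qed.

Lemma lin_comp S T : linear S -> linear T -> linear (S \o T).
Proof. by move=> hS hT a x y /=; rewrite hT hS. Qed.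

Lemma lin_addZ S T a : linear S -> linear T -> linear (fun x => S x + a *: T x).
Proof.
move=> hS hT b x y; rewrite hS hT !scalerDr !scalerA (mulrC a b).
by rewrite addrACA.
Qed.

Lemma lin_subZ S T a : linear S -> linear T -> linear (fun x => S x - a *: T x).
Proof.
move=> hS hT b x y; rewrite hS hT !scalerDr !scalerA (mulrC a b) scalerN scalerA opprD.
by rewrite addrACA.
Qed.

(** Real nonnegative bounds, whereas the constant in [bounded_op] is an element of R[i] of
    unspecified sign. *)
Definition opb T M := 0 <= M /\ forall x, nrm (T x) <= M * nrm x.

Lemma opb_comp S T M N : opb S M -> opb T N -> opb (S \o T) (M * N).
Proof.
move=> [M0 hS] [N0 hT]; split; first exact: mulr_ge0.
by move=> x /=; rewrite (le_trans (hS _)) // -mulrA ler_wpM2l.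
Qed.

Lemma opb_id : opb (id : H -> H) 1.
Proof. by split => // x; rewrite mul1r. Qed.

Lemma opb_addZ S T a M N : opb S M -> opb T N ->
  opb (fun x => S x + a *: T x) (M + nrm a * N).
Proof.
move=> [M0 hS] [N0 hT]; split; first by rewrite addr_ge0 // mulr_ge0 ?nrm_ge0.
move=> x; rewrite (le_trans (nrmD _ _)) // mulrDl lerD // nrmZ -mulrA.
by rewrite ler_wpM2l ?nrm_ge0.
Qed.

Lemma opb_subZ S T a M N : opb S M -> opb T N ->
  opb (fun x => S x - a *: T x) (M + nrm a * N).
Proof.
move=> hS hT; rewrite -(nrmN a).
have -> : (fun x => S x - a *: T x) = (fun x => S x + (- a) *: T x).
  by apply/funext => x; rewrite scaleNr.
exact: opb_addZ.
Qed.

Lemma bounded_opP T : bounded_op T <-> linear T /\ exists M, opb T M.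
Proof.
split=> -[l [M hM]]; split => //.
  exists (nrm M); split=> [|x]; first exact: nrm_ge0.
  rewrite -lecR rmorphM /= -!nrmE; apply: (le_trans (hM x)).
  (* [M] is not known to be real, but this product dominates a norm, so it equals its own
     modulus. *)
  have h0 : 0 <= M * `|x| by apply: (le_trans _ (hM x)); rewrite normr_ge0.
  by rewrite -(ger0_norm h0) normrM normr_id.
exists M%:C => x; rewrite !nrmE -rmorphM lecR; exact: hM.2.
Qed.

Lemma bounded_op_lin T : bounded_op T -> linear T.
Proof. by case. Qed.

Lemma bounded_op_comp S T : bounded_op S -> bounded_op T -> bounded_op (S \o T).
Proof.
move=> /bounded_opP[lS [M hM]] /bounded_opP[lT [N hN]]; apply/bounded_opP.
by split; [exact: lin_comp | exists (M * N); exact: opb_comp].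
Qed.

Lemma bounded_op_id : bounded_op (id : H -> H).
Proof. by apply/bounded_opP; split; [exact: lin_id | exists 1; exact: opb_id]. Qed.

Lemma bounded_op_iter T n : bounded_op T -> bounded_op (iter n T).
Proof.
by move=> bT; elim: n => [|n IH]; [exact: bounded_op_id | exact: bounded_op_comp IH].
Qed.

Lemma bounded_op_subZ S T a : bounded_op S -> bounded_op T ->
  bounded_op (fun x => S x - a *: T x).
Proof.
move=> /bounded_opP[lS [M hM]] /bounded_opP[lT [N hN]]; apply/bounded_opP.
split; first exact: lin_subZ.
by exists (M + nrm a * N); exact: opb_subZ.
Qed.

Lemma bounded_op_addZ S T a : bounded_op S -> bounded_op T ->
  bounded_op (fun x => S x + a *: T x).
Proof.
move=> /bounded_opP[lS [M hM]] /bounded_opP[lT [N hN]]; apply/bounded_opP.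
split; first exact: lin_addZ.
by exists (M + nrm a * N); exact: opb_addZ.
Qed.

Lemma bounded_op_shift T a : bounded_op T -> bounded_op (fun x => T x - a *: x).
Proof. by move=> bT; apply: bounded_op_subZ => //; exact: bounded_op_id. Qed.

Lemma bounded_op_scale T a : bounded_op T -> bounded_op (fun x => a *: T x).
Proof.
move=> /bounded_opP[lT [N [N0 hN]]]; apply/bounded_opP; split.
  by move=> b x y; rewrite lT scalerDr !scalerA mulrC.
exists (nrm a * N); split; first by rewrite mulr_ge0 ?nrm_ge0.
by move=> x; rewrite nrmZ -mulrA ler_wpM2l ?nrm_ge0.
Qed.

Lemma bounded_op_continuous T (u : nat -> H) l : bounded_op T ->
  tends u l -> tends (T \o u) (T l).
Proof.
move=> /bounded_opP[lT [M [M0 hM]]] ul e e0.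
have [N hN] := ul (e / (M + 1)) (divr_gt0 e0 (ltr_wpDl M0 ltr01)).
exists N => n /hN h /=; rewrite -linB // (le_trans (hM _)) //.
apply: (@le_trans _ _ ((M + 1) * (e / (M + 1)))).
  by rewrite ler_pM // ?nrm_ge0 // lerDl.
by rewrite mulrC divfK // gt_eqF // ltr_wpDl.
Qed.

(** Shaped so that [spectrum T mu] is, up to conversion, the failure of [invertible] for T - mu. *)
Definition invertible T := exists S,
  [/\ bounded_op S, forall x, S (T x) = x & forall x, T (S x) = x].

Lemma invertible_id : invertible (id : H -> H).
Proof. by exists id; split=> //; exact: bounded_op_id. Qed.

Lemma invertible_comp S T : invertible S -> invertible T -> invertible (S \o T).
Proof.
move=> [S' [bS S1 S2]] [T' [bT T1 T2]]; exists (T' \o S'); split=> [|x|x] /=.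
- exact: bounded_op_comp.
- by rewrite S1 T1.
- by rewrite T2 S2.
Qed.

Lemma invertible_scale a T : linear T -> a != 0 ->
  invertible T -> invertible (fun x => a *: T x).
Proof.
move=> lT a0 [S [bS S1 S2]]; exists (fun x => a^-1 *: S x); split=> [|x|x].
- exact: bounded_op_scale.
- by rewrite linZ ?S1 ?scalerA ?mulVf ?scale1r //; exact: bounded_op_lin.
- by rewrite linZ // S2 scalerA mulfV // scale1r.
Qed.

(** The lower bound makes approximate preimages of y a Cauchy sequence, so a dense range is
    everything; it also gives injectivity and the bound 1/c on the inverse. *)
Lemma invertible_of_dense B c : bounded_op B -> 0 < c ->
  (forall x, c * nrm x <= nrm (B x)) ->
  (forall y (e : R), 0 < e -> exists x, nrm (y - B x) <= e) -> invertible B.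
Proof.
move=> bB c0 hc hd; have lB := bounded_op_lin bB.
have surj y : exists x, B x = y.
  have /choice[u hu] : forall n : nat, exists x, nrm (y - B x) <= n.+1%:R^-1.
    by move=> n; apply: hd; rewrite invr_gt0.
  have Bu : tends (B \o u) y.
    move=> e e0; have [N hN] := invSn_le e0; exists N => n /hN h /=.
    by rewrite nrmBC (le_trans (hu n)).
  have [|l ul] := @nrm_cauchy_tends _ _ u.
    move=> e e0; have [N hN] := Bu (c * e / 2) ltac:(by rewrite divr_gt0 // mulr_gt0).
    exists N => m n hm hn; rewrite -(ler_pM2l c0) (le_trans (hc _)) // linB //.
    rewrite (le_trans (nrm_dist_le _ y _)) // (nrmBC y).
    have := hN _ hm; have := hN _ hn => /=; lra.
  by exists l; exact: (tends_unique (bounded_op_continuous bB ul)).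
have inj x x' : B x = B x' -> x = x'.
  move=> e; apply/eqP; rewrite -subr_eq0; apply/eqP/nrm_le0.
  by rewrite -(ler_pM2l c0) mulr0 (le_trans (hc _)) // linB // e subrr nrm0.
have [S hS] := choice surj.
exists S; split=> //; last by move=> x; apply: inj; rewrite hS.
apply/bounded_opP; split; first by move=> a x y; apply: inj; rewrite lB !hS.
exists c^-1; split=> [|x]; first by rewrite invr_ge0 ltW.
by rewrite -(ler_pM2l c0) mulrA mulfV ?gt_eqF // mul1r -{2}(hS x).
Qed.

End Operators.

(** * Orthogonal projection, the coercivity criterion, Riesz representation, adjoints *)

Section InnerProduct.
Variables (R : realType) (H : completeNormedModType R[i]).
Variable dot : {dot H for conjC}.
Hypothesis dot_norm : forall x : H, dot x x = `|x| ^+ 2.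
Implicit Types (x y z v w : H) (A B S T : H -> H) (a : R[i]).

Lemma dotDl x y z : dot (x + y) z = dot x z + dot y z.
Proof. exact: linearDl. Qed.
Lemma dotDr x y z : dot x (y + z) = dot x y + dot x z.
Proof. exact: linearDr. Qed.
Lemma dotBl x y z : dot (x - y) z = dot x z - dot y z.
Proof. exact: linearBl. Qed.
Lemma dotBr x y z : dot x (y - z) = dot x y - dot x z.
Proof. exact: linearBr. Qed.
Lemma dotZl a x y : dot (a *: x) y = a * dot x y.
Proof. by rewrite linearZl_LR. Qed.
Lemma dotZr a x y : dot x (a *: y) = a^*%R * dot x y.
Proof. by rewrite linearZr_LR. Qed.
Lemma dot0l x : dot 0 x = 0.
Proof. exact: linear0l. Qed.
Lemma dot0r x : dot x 0 = 0.
Proof. exact: linear0r. Qed.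
Lemma dotC x y : dot x y = (dot y x)^*%R.
Proof. by rewrite hermC expr0 mul1r. Qed.

Lemma dot_suml (I : Type) (r : seq I) (P : pred I) (F : I -> H) y :
  dot (\sum_(i <- r | P i) F i) y = \sum_(i <- r | P i) dot (F i) y.
Proof.
by apply: (big_morph (fun x => dot x y)); [move=> a b; exact: dotDl | exact: dot0l].
Qed.

Lemma dot_sumr (I : Type) (r : seq I) (P : pred I) (F : I -> H) x :
  dot x (\sum_(i <- r | P i) F i) = \sum_(i <- r | P i) dot x (F i).
Proof. by apply: (big_morph (dot x)); [exact: dotDr | exact: dot0r]. Qed.

Lemma dotxx x : dot x x = (nrm x ^+ 2)%:C.
Proof. by rewrite dot_norm nrmE rmorphXn. Qed.

Lemma Re_dotC x y : complex.Re (dot x y) = complex.Re (dot y x).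
Proof. by rewrite dotC; case: (dot y x). Qed.

Lemma nrmD_sq x y :
  nrm (x + y) ^+ 2 = nrm x ^+ 2 + nrm y ^+ 2 + 2 * complex.Re (dot x y).
Proof.
have -> : nrm (x + y) ^+ 2 = complex.Re (dot (x + y) (x + y)) by rewrite dotxx.
rewrite !dotDl !dotDr !raddfD /= (Re_dotC y x) !dotxx /=.
ring.
Qed.

Lemma nrmB_sq x y :
  nrm (x - y) ^+ 2 = nrm x ^+ 2 + nrm y ^+ 2 - 2 * complex.Re (dot x y).
Proof.
have -> : nrm (x - y) ^+ 2 = complex.Re (dot (x - y) (x - y)) by rewrite dotxx.
rewrite !dotBl !dotBr !raddfB /= (Re_dotC y x) !dotxx /=.
ring.
Qed.

Lemma parallelogram x y :
  nrm (x - y) ^+ 2 = 2 * nrm x ^+ 2 + 2 * nrm y ^+ 2 - nrm (x + y) ^+ 2.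
Proof. rewrite nrmB_sq nrmD_sq; ring. Qed.

(* Compare y with y - a v at the optimal a = dot y v / |v|^2. *)
Lemma nrm_dot_le_of_near_min y v (eta : R) :
  (forall a, nrm y ^+ 2 - eta <= nrm (y - a *: v) ^+ 2) ->
  nrm (dot y v) ^+ 2 <= eta * nrm v ^+ 2.
Proof.
move=> h; have [->|v0] := eqVneq v 0.
  by rewrite dot0r !nrm0 expr0n /= mulr0.
have nv : 0 < nrm v ^+ 2.
  by rewrite exprn_gt0 // lt_def nrm_ge0 nrm_eq0 v0.
set m := nrm v ^+ 2 in nv *; set d := nrm (dot y v) ^+ 2.
have := h ((m^-1)%:C * dot y v).
have -> : nrm (y - ((m^-1)%:C * dot y v) *: v) ^+ 2 = nrm y ^+ 2 - d / m.
  rewrite nrmB_sq nrmZ dotZr nrmM nrmC rmorphM /= !exprMn -/m -/d.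
  have -> : ((m^-1)%:C^* = (m^-1)%:C)%R by rewrite conj_Creal // complex_real.
  rewrite -[X in complex.Re X]mulrA [conjC (dot y v) * _]mulrC -normCK nrmE.
  rewrite -rmorphXn -rmorphM /= -/d.
  rewrite ger0_norm ?invr_ge0 ?ltW //; field.
  by rewrite gt_eqF.
by rewrite lerD2l lerN2 ler_pdivrMr.
Qed.

(** Cauchy-Schwarz is the case [eta = nrm x ^+ 2] of the near-minimum estimate, whose hypothesis
    then says that a square is nonnegative. *)
Lemma nrm_dot x y : nrm (dot x y) <= nrm x * nrm y.
Proof.
rewrite -ler_sqr ?nnegrE ?mulr_ge0 ?nrm_ge0 // exprMn.
by apply: nrm_dot_le_of_near_min => a; rewrite subrr sqr_ge0.
Qed.

Definition lin_subspace (P : H -> Prop) :=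
  P 0 /\ forall a x y, P x -> P y -> P (a *: x + y).

(** [P] need not be closed, so [x0] lies only in its closure. It is the limit of a minimizing
    sequence for the distance to [x], Cauchy by the parallelogram law; near-minimality gives
    near-orthogonality, exact in the limit. *)
Lemma projection (P : H -> Prop) x : lin_subspace P -> exists x0,
  (forall e : R, 0 < e -> exists v, P v /\ nrm (x0 - v) <= e) /\
  (forall v, P v -> dot (x - x0) v = 0).
Proof.
move=> [P0 PD].
pose D := [set nrm (x - v) ^+ 2 | v in P].
have lbD : has_lbound D by exists 0 => _ [v _ <-]; exact: sqr_ge0.
have iD : has_inf D by split => //; exists (nrm (x - 0) ^+ 2), 0.
have dle v : P v -> inf D <= nrm (x - v) ^+ 2 by move=> Pv; apply: ge_inf => //; exists v.
have /choice[u hu] : forall n : nat, exists v, P v /\ nrm (x - v) ^+ 2 <= inf D + n.+1%:R^-1.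
  move=> n; have n0 : 0 < n.+1%:R^-1 :> R by rewrite invr_gt0.
  have [_ [v Pv <-] hv] := inf_adherent n0 iD.
  by exists v; split=> //; exact: ltW.
have uu m n : nrm (u m - u n) ^+ 2 <= 2 * m.+1%:R^-1 + 2 * n.+1%:R^-1.
  have := parallelogram (x - u n) (x - u m).
  have -> : x - u n - (x - u m) = u m - u n.
    by rewrite opprB addrC addrA subrK.
  (* The midpoint of [u n] and [u m] lies in [P], so its distance to [x] is at least the infimum. *)
  have -> : x - u n + (x - u m) = 2%:C *: (x - 2^-1%:C *: (u n + u m)).
    rewrite scalerBr scalerA -rmorphM mulfV ?pnatr_eq0 // scale1r.
    have -> : 2%:C = 1 + 1 :> R[i] by rewrite rmorphD.
    by rewrite scalerDl scale1r opprD addrACA.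
  rewrite nrmZC normr_nat exprMn => ->.
  have := dle (2^-1%:C *: (u n + u m)).
  have Pm : P (2^-1%:C *: (u n + u m)).
    rewrite scalerDr; apply: (PD _ _ _); first exact: (hu n).1.
    by rewrite -[_ *: _]addr0; apply: (PD _ _ _) => //; exact: (hu m).1.
  move=> /(_ Pm).
  have := (hu m).2; have := (hu n).2.
  move: (m.+1%:R^-1) (n.+1%:R^-1) (inf D) => i j d; lra.
have [|x0 hx0] := @nrm_cauchy_tends _ _ u.
  move=> e e0; have e2 : 0 < e ^+ 2 / 4 by rewrite divr_gt0 // exprn_gt0.
  have [N hN] := invSn_le e2; exists N => m n hm hn.
  rewrite -ler_sqr ?nnegrE ?nrm_ge0 ?(ltW e0) //; have := uu m n.
  have := hN _ hm; have := hN _ hn.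
  move: (m.+1%:R^-1) (n.+1%:R^-1) => i j; lra.
exists x0; split=> [e e0|v Pv].
  have [N hN] := hx0 e e0; exists (u N); split; first exact: (hu N).1.
  by rewrite nrmBC hN.
apply: nrm_eps0 => e e0.
pose K := nrm v + 1; have K0 : 0 < K by rewrite ltr_wpDl ?nrm_ge0.
have d0 : 0 < (e / 2 / K) by rewrite !divr_gt0.
have d1 : 0 < (e / 2 / K) ^+ 2 by rewrite exprn_gt0.
have [N1 h1] := hx0 _ d0; have [N2 h2] := invSn_le d1.
pose n := maxn N1 N2.
have a1 : nrm (dot (x - u n) v) <= e / 2.
  rewrite -ler_sqr ?nnegrE ?nrm_ge0 ?divr_ge0 ?(ltW e0) //.
  have /le_trans-> // : nrm (dot (x - u n) v) ^+ 2 <= n.+1%:R^-1 * nrm v ^+ 2.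
    apply: nrm_dot_le_of_near_min => a.
    have := dle (a *: v + u n) (PD _ _ _ Pv (hu n).1).
    rewrite opprD [- _ - _]addrC addrA => h.
    by rewrite lerBlDr (le_trans (hu n).2) // lerD2r.
  apply: (@le_trans _ _ ((e / 2 / K) ^+ 2 * K ^+ 2)).
    rewrite ler_pM ?invr_ge0 ?sqr_ge0 ?h2 ?leq_maxr //.
    by rewrite ler_sqr ?nnegrE ?nrm_ge0 ?(ltW K0) // /K lerDl.
  by rewrite -exprMn divfK // gt_eqF.
have a2 : nrm (dot (u n - x0) v) <= e / 2.
  rewrite (le_trans (nrm_dot _ _)) //.
  apply: (@le_trans _ _ ((e / 2 / K) * K)); last by rewrite divfK // gt_eqF.
  by rewrite ler_pM ?nrm_ge0 ?h1 ?leq_maxl // /K; lra.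
have -> : x - x0 = (x - u n) + (u n - x0) by rewrite addrA subrK.
rewrite dotDl (le_trans (nrmD _ _)) //; lra.
Qed.

Lemma dense_of_orthogonal (P : H -> Prop) : lin_subspace P ->
  (forall w, (forall v, P v -> dot w v = 0) -> w = 0) ->
  forall x (e : R), 0 < e -> exists v, P v /\ nrm (x - v) <= e.
Proof.
move=> sP h x e e0; have [x0 [h1 h2]] := projection x sP.
have /eqP := h _ h2; rewrite subr_eq0 => /eqP ->; exact: h1.
Qed.

(** The Lax-Milgram argument: Cauchy-Schwarz turns coercivity into a lower bound for |Bx|, and a
    vector w orthogonal to the range satisfies <Bw,w> = 0, hence w = 0. *)
Lemma coercive_invertible B (c : R) : bounded_op B -> 0 < c ->
  (forall x, c * nrm x ^+ 2 <= nrm (dot (B x) x)) -> invertible B.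
Proof.
move=> bB c0 hc; have lB := bounded_op_lin bB.
apply: (@invertible_of_dense _ _ _ c) => // [x|y e e0].
  have [->|x0] := eqVneq x 0; first by rewrite nrm0 mulr0 nrm_ge0.
  have nx : 0 < nrm x by rewrite lt_def nrm_ge0 nrm_eq0 x0.
  by rewrite -(ler_pM2r nx) -mulrA -expr2 (le_trans (hc x)) // nrm_dot.
have sP : lin_subspace (fun y => exists x, B x = y).
  split; first by exists 0; exact: lin0.
  by move=> a _ _ [u <-] [v <-]; exists (a *: u + v); exact: lB.
have [] := @dense_of_orthogonal _ sP _ y e e0.
  move=> w hw; apply: nrm_le0; have := hc w.
  rewrite dotC (hw (B w)) ?nrm_conj ?nrm0; last by exists w.
  by rewrite pmulr_rle0 // exprn_even_le0 //= => /eqP ->.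
by move=> _ [[x <-] hx]; exists x.
Qed.

Lemma dot_ext x y : (forall z, dot z x = dot z y) -> x = y.
Proof.
move=> h; apply/eqP; rewrite -subr_eq0 -nrm_eq0 -(sqrf_eq0 (nrm _)).
by rewrite -(inj_eq (@complexI R)) -dotxx dotBr h subrr.
Qed.

Lemma riesz (phi : H -> R[i]) (M : R) :
  (forall a x y, phi (a *: x + y) = a * phi x + phi y) ->
  (forall x, nrm (phi x) <= M * nrm x) ->
  exists z, forall x, phi x = dot x z.
Proof.
move=> lphi bphi.
have phi0 : phi 0 = 0 by apply: nrm_le0; rewrite (le_trans (bphi 0)) // nrm0 mulr0.
have [h|/existsNP[u hu]] := pselect (forall x, phi x = 0).
  by exists 0 => x; rewrite h dot0r.
have sP : lin_subspace (fun x => phi x = 0).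
  by split=> // a x y hx hy; rewrite lphi hx hy mulr0 addr0.
have phiB x y : phi (x - y) = phi x - phi y.
  by rewrite addrC -scaleN1r lphi mulN1r addrC.
have [u0 [h1 h2]] := projection u sP.
have M0 : 0 <= M.
  have [u00|u0N] := eqVneq u 0; first by rewrite u00 phi0 in hu.
  have nu : 0 < nrm u by rewrite lt_def nrm_ge0 nrm_eq0 u0N.
  by rewrite -(ler_pM2r nu) mul0r (le_trans (nrm_ge0 (phi u))).
(* The projection is only in the closure of the kernel; boundedness of [phi] puts it in the
   kernel. *)
have phiu0 : phi u0 = 0.
  apply: nrm_eps0 => e e0.
  have [v [hv huv]] := h1 (e / (M + 1)) (divr_gt0 e0 (ltr_wpDl M0 ltr01)).
  have -> : phi u0 = phi (u0 - v) by rewrite phiB hv subr0.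
  rewrite (le_trans (bphi _)) //.
  apply: (@le_trans _ _ ((M + 1) * (e / (M + 1)))).
    by rewrite ler_pM // ?nrm_ge0 // lerDl.
  by rewrite mulrC divfK // gt_eqF // ltr_wpDl.
pose w := u - u0; have phiw : phi w != 0 by rewrite phiB phiu0 subr0; apply/eqP.
have w0 : dot w w != 0.
  rewrite dotxx (inj_eq (@complexI R)) sqrf_eq0 nrm_eq0.
  by apply: contra_neq phiw => ->.
exists ((phi w / dot w w)^*%R *: w) => x.
(* Removing the right multiple of [w] from [x] lands in the kernel, to which [w] is orthogonal; this
   determines the representing multiple of [w]. *)
have hk : phi (- (phi x / phi w) *: w + x) = 0.
  by rewrite lphi mulNr divfK // addNr.
have := h2 _ hk; rewrite -/w dotC => /eqP; rewrite conjC_eq0 dotDl dotZl.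
rewrite mulNr addrC subr_eq0 => /eqP h.
rewrite dotZr conjCK h mulrAC mulrA; field; rewrite ?phiw ?w0 //.
Qed.

Definition is_adjoint T S := forall x y, dot (T x) y = dot x (S y).

Lemma adjoint_exists T : bounded_op T -> exists S, bounded_op S /\ is_adjoint T S.
Proof.
move=> bT; have lT := bounded_op_lin bT; have /bounded_opP[_ [M [M0 hM]]] := bT.
have /choice[S hS] : forall y, exists z, forall x, dot (T x) y = dot x z.
  move=> y; apply: (@riesz _ (M * nrm y)) => [a x z|x].
    by rewrite lT dotDl dotZl.
  by rewrite (le_trans (nrm_dot _ _)) // mulrAC ler_wpM2r ?nrm_ge0.
exists S; split; last by move=> x y; exact: hS.
apply/bounded_opP; split.
  by move=> a x y; apply: dot_ext => z; rewrite -hS !dotDr !dotZr !hS.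
exists M; split=> // y.
have [->|Sy0] := eqVneq (S y) 0; first by rewrite nrm0 mulr_ge0 // nrm_ge0.
have nS : 0 < nrm (S y) by rewrite lt_def nrm_ge0 nrm_eq0 Sy0.
rewrite -(ler_pM2r nS) -expr2 mulrAC.
have -> : nrm (S y) ^+ 2 = nrm (dot (S y) (S y)) by rewrite dotxx nrmC ger0_norm ?sqr_ge0.
by rewrite -hS (le_trans (nrm_dot _ _)) // ler_wpM2r ?nrm_ge0.
Qed.

Lemma adjointP T : bounded_op T ->
  bounded_op (adjoint dot T) /\ is_adjoint T (adjoint dot T).
Proof.
by move=> /adjoint_exists h; exact: (@getPex _ [set S | bounded_op S /\ is_adjoint T S] h).
Qed.

End InnerProduct.

(** * Polynomials in an operator and the spectrum *)

Section PolynomialCalculus.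
Variables (R : realType) (H : completeNormedModType R[i]).
Implicit Types (x y : H) (T : H -> H) (p q : {poly R[i]}).

(** Complex coefficients, unlike [op_poly], so that polynomials split into linear factors. *)
Definition cpoly p T : H -> H := fun x => \sum_(i < size p) p`_i *: iter i T x.

Lemma cpoly_widen n p T x : (size p <= n)%N ->
  cpoly p T x = \sum_(i < n) p`_i *: iter i T x.
Proof.
move=> hn; rewrite /cpoly (big_ord_widen n (fun i => p`_i *: iter i T x)) //.
rewrite big_mkcond; apply: eq_bigr => i _.
by case: ltnP => // h; rewrite nth_default // scale0r.
Qed.

Lemma cpolyD p q T x : cpoly (p + q) T x = cpoly p T x + cpoly q T x.
Proof.
pose n := maxn (size p) (size q).
rewrite !(@cpoly_widen n) ?size_polyD ?leq_maxl ?leq_maxr //.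
by rewrite -big_split /=; apply: eq_bigr => i _; rewrite coefD scalerDl.
Qed.

Lemma cpolyZ a p T x : cpoly (a *: p) T x = a *: cpoly p T x.
Proof.
rewrite !(@cpoly_widen (size p)) ?size_scale_leq // scaler_sumr.
by apply: eq_bigr => i _; rewrite coefZ scalerA.
Qed.

Lemma cpolyC a T x : cpoly a%:P T x = a *: x.
Proof. by rewrite (@cpoly_widen 1) ?size_polyC_leq1 // big_ord1 coefC. Qed.

Lemma cpolyMX p T x : linear T -> cpoly (p * 'X) T x = T (cpoly p T x).
Proof.
move=> lT; rewrite (@cpoly_widen (size p).+1); last first.
  have [->|p0] := eqVneq p 0; first by rewrite mul0r size_poly0.
  by rewrite size_mulX.
rewrite big_ord_recl coefMX /= scale0r add0r lin_sum //.
by apply: eq_bigr => i _; rewrite coefMX /= linZ.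
Qed.

Lemma cpolyX T x : linear T -> cpoly 'X T x = T x.
Proof. by move=> lT; rewrite -['X]mul1r cpolyMX // cpolyC scale1r. Qed.

Lemma cpolyM p q T x : linear T -> cpoly (p * q) T x = cpoly p T (cpoly q T x).
Proof.
move=> lT; elim/poly_ind: p => [|p c IH]; first by rewrite mul0r !cpolyC !scale0r.
rewrite mulrDl mulrAC mul_polyC !cpolyD cpolyZ !cpolyMX // IH.
by rewrite cpolyC.
Qed.

Lemma bounded_op_cpoly p T : bounded_op T -> bounded_op (cpoly p T).
Proof.
move=> bT; have lT := bounded_op_lin bT; elim/poly_ind: p => [|p c IH].
  have -> : cpoly 0 T = (fun x => 0 *: x) by apply/funext => x; rewrite cpolyC.
  by apply: bounded_op_scale; exact: bounded_op_id.
have -> : cpoly (p * 'X + c%:P) T = (fun x => (T \o cpoly p T) x + c *: x).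
  by apply/funext => x; rewrite cpolyD cpolyMX // cpolyC.
by apply: bounded_op_addZ; [exact: bounded_op_comp | exact: bounded_op_id].
Qed.

(** If no root were in the spectrum, p(T) would be a nonzero scalar times a product of invertible
    factors T - z. *)
Lemma spectrum_cpoly_root p T : bounded_op T -> p != 0 ->
  ~ invertible (cpoly p T) -> exists2 z, root p z & spectrum T z.
Proof.
move=> bT p0; have lT := bounded_op_lin bT.
have [rs Dp] := closed_field_poly_normal p.
move=> ninv; apply: contrapT => h; apply: ninv.
have hz z : z \in rs -> invertible (fun x => T x - z *: x).
  move=> zrs; apply: contrapT => nz; apply: h; exists z => //.
  by rewrite Dp rootZ ?lead_coef_eq0 // root_prod_XsubC.
have -> : cpoly p T = (fun x => lead_coef p *: cpoly (\prod_(z <- rs) ('X - z%:P)) T x).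
  by apply/funext => x; rewrite {1}Dp cpolyZ.
apply: invertible_scale; [|by rewrite lead_coef_eq0|].
  by apply: bounded_op_lin; exact: bounded_op_cpoly.
elim: rs hz {Dp} => [|z rs IH] hz.
  rewrite big_nil; have -> : cpoly 1 T = id by apply/funext => x; rewrite cpolyC scale1r.
  exact: invertible_id.
rewrite big_cons.
have -> : cpoly (('X - z%:P) * \prod_(j <- rs) ('X - j%:P)) T =
    (fun x => T x - z *: x) \o cpoly (\prod_(j <- rs) ('X - j%:P)) T.
  apply/funext => x; rewrite cpolyM // -polyCN cpolyD cpolyX // cpolyC.
  by rewrite scaleNr.
apply: invertible_comp; first by apply: hz; rewrite mem_head.
by apply: IH => y yrs; apply: hz; rewrite in_cons yrs orbT.
Qed.

Lemma op_polyE (p : {poly R}) T : op_poly p T = cpoly (map_poly (real_complex R) p) T.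
Proof.
apply/funext => x; rewrite /op_poly (@cpoly_widen (size p)) ?size_map_poly //.
by apply: eq_bigr => i _; rewrite coef_map.
Qed.

Lemma bounded_op_poly (p : {poly R}) T : bounded_op T -> bounded_op (op_poly p T).
Proof. by rewrite op_polyE; exact: bounded_op_cpoly. Qed.

Lemma op_polyM (p q : {poly R}) T x : linear T ->
  op_poly (p * q) T x = op_poly p T (op_poly q T x).
Proof. by move=> lT; rewrite !op_polyE rmorphM /= cpolyM. Qed.

Lemma op_polyB (p q : {poly R}) T x :
  op_poly (p - q) T x = op_poly p T x - op_poly q T x.
Proof. by rewrite !op_polyE rmorphB /= cpolyD -scaleN1r cpolyZ scaleN1r. Qed.

Lemma op_polyC (c : R) T x : op_poly c%:P T x = c%:C *: x.
Proof. by rewrite op_polyE map_polyC cpolyC. Qed.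

Lemma op_polyX T x : linear T -> op_poly 'X T x = T x.
Proof. by move=> lT; rewrite op_polyE map_polyX cpolyX. Qed.

End PolynomialCalculus.

Section OperatorNorm.
Variables (R : realType) (H : completeNormedModType R[i]).
Implicit Types (x y : H) (T : H -> H).

Let unit_values T := [set complex.Re `|T x| | x in [set x : H | `|x| <= 1]].

Lemma nrm_le1 (x : H) : (`|x| <= 1) = (nrm x <= 1).
Proof. by rewrite nrmE -(lecR _ 1). Qed.

Lemma op_norm_has_sup T : bounded_op T -> has_sup (unit_values T).
Proof.
move=> /bounded_opP[lT [M [M0 hM]]]; split.
  by exists (nrm (T 0)), 0 => //=; rewrite normr0 ler01.
exists M => _ [x /= + <-]; rewrite nrm_le1 => x1.
by rewrite (le_trans (hM x)) // ler_piMr.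
Qed.

Lemma op_norm_ge0 T : bounded_op T -> 0 <= op_norm T.
Proof.
move=> bT; rewrite (le_trans (nrm_ge0 (T 0))) // /op_norm.
apply: ub_le_sup; first exact: (op_norm_has_sup bT).2.
by exists 0 => //=; rewrite normr0 ler01.
Qed.

Lemma op_normP T x : bounded_op T -> nrm (T x) <= op_norm T * nrm x.
Proof.
move=> bT; have lT := bounded_op_lin bT.
have [->|x0] := eqVneq x 0; first by rewrite lin0 // nrm0 mulr0.
have nx : 0 < nrm x by rewrite lt_def nrm_ge0 nrm_eq0 x0.
have -> : nrm (T x) = nrm (T ((nrm x)^-1%:C *: x)) * nrm x.
  rewrite linZ // nrmZC ger0_norm ?invr_ge0 ?nrm_ge0 // mulrAC mulVf ?mul1r //.
  by rewrite gt_eqF.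
rewrite ler_wpM2r ?nrm_ge0 //.
apply: ub_le_sup; first exact: (op_norm_has_sup bT).2.
exists ((nrm x)^-1%:C *: x) => //=.
by rewrite nrm_le1 nrmZC ger0_norm ?invr_ge0 ?nrm_ge0 // mulVf // gt_eqF.
Qed.

Lemma op_norm_le T (M : R) : opb T M -> op_norm T <= M.
Proof.
move=> [M0 hM]; apply: ge_sup.
  by exists (nrm (T 0)), 0 => //=; rewrite normr0 ler01.
move=> _ [x /= + <-]; rewrite nrm_le1 => x1.
by rewrite (le_trans (hM x)) // ler_piMr.
Qed.

Lemma op_norm_adherent T (e : R) : bounded_op T -> 0 < e ->
  exists2 x, nrm x <= 1 & op_norm T - e < nrm (T x).
Proof.
move=> bT e0; have [_ [x /= x1 <-] h] := sup_adherent e0 (op_norm_has_sup bT).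
by exists x => //; rewrite -nrm_le1.
Qed.

End OperatorNorm.

(** * Self-adjoint operators: the norm of p(A) is a value of |p| on the spectrum *)

Section SelfAdjoint.
Variables (R : realType) (H : completeNormedModType R[i]).
Variable dot : {dot H for conjC}.
Hypothesis dot_norm : forall x : H, dot x x = `|x| ^+ 2.
Hypothesis H_neq0 : exists x : H, x != 0.
Implicit Types (x y : H) (A B T : H -> H).

Definition selfadj A := is_adjoint dot A A.

Lemma selfadj_dot_real A x : selfadj A -> complex.Im (dot (A x) x) = 0.
Proof.
move=> /(_ x x); rewrite [RHS]dotC; case: (dot (A x) x) => a b /= [] /eqP.
by rewrite -subr_eq0 opprK -mulr2n mulrn_eq0 /= => /eqP.
Qed.

(** Since <Ax,x> is real, |<(A - z)x,x>| >= |Im z| |x|^2, and coercivity applies unless Im z = 0. *)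
Lemma spectrum_selfadj_real A z : bounded_op A -> selfadj A ->
  spectrum A z -> z = (complex.Re z)%:C.
Proof.
move=> bA sA hz.
have [/eqP z0|z0] := eqVneq (complex.Im z) 0.
  by rewrite {1}(complexE z) (eqP z0) mulr0 addr0.
case: hz; apply: (@coercive_invertible _ _ dot dot_norm _ `|complex.Im z|).
- exact: bounded_op_shift.
- by rewrite normr_gt0.
- move=> x; rewrite dotBl dotZl dotxx //.
  apply: le_trans (Im_le_nrm _).
  rewrite raddfB /= selfadj_dot_real // sub0r normrN.
  by case: z {z0} => a b /=; rewrite mulr0 add0r normrM (ger0_norm (sqr_ge0 (nrm x))).
Qed.

Lemma selfadj_poly (p : {poly R}) A : selfadj A -> selfadj (op_poly p A).
Proof.
move=> sA x y; rewrite /op_poly dot_suml dot_sumr; apply: eq_bigr => i _.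
rewrite dotZl dotZr conj_Creal ?complex_real //; congr (_ * _).
by elim: (i : nat) x y => [//|n IH] x y; rewrite iterS sA IH -iterSr.
Qed.

(* Vectors at which B almost attains its norm c are almost killed by B^2 - c^2. *)
Lemma selfadj_norm_in_spectrum B : bounded_op B -> selfadj B ->
  ~ invertible (fun x => B (B x) - (op_norm B ^+ 2)%:C *: x).
Proof.
move=> bB sB [S [bS S1 _]]; have lB := bounded_op_lin bB.
have c0 := op_norm_ge0 bB.
have hB x := op_normP x bB; set c := op_norm B in c0 hB *.
(* If c = 0 then B = 0 and the operator to be inverted is 0, impossible on a nonzero space. *)
have [cE|cN] := eqVneq c 0.
  have [x /eqP] := H_neq0; apply; have := S1 x.
  rewrite -/c cE expr0n scale0r subr0.
  have B0 y : B y = 0 by apply: nrm_le0; rewrite (le_trans (hB y)) // cE mul0r.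
  by rewrite !B0 lin0 //; exact: bounded_op_lin.
have cp : 0 < c by rewrite lt_def cN.
have /bounded_opP[_ [K [K0 hK]]] := bS.
(* With t = |Bx| > c - e, the estimates below are c^2 - t^2 <= 2ce and t^2 <= K^2 c^4 2ce. They add
   up to c^2 <= 2ceL, and e = c/(4L) makes the right side c^2/2, a contradiction. *)
pose L := 1 + K ^+ 2 * c ^+ 4.
have L0 : 0 < L by rewrite ltr_pwDl // mulr_ge0 // exprn_ge0.
have L1 : 1 <= L by rewrite lerDl mulr_ge0 // exprn_ge0.
pose e := c / (4 * L).
have e0 : 0 < e by rewrite divr_gt0 // mulr_gt0.
have eL : 4 * L * e = c by rewrite /e mulrC divfK // gt_eqF // mulr_gt0.
have [x x1 xe] := op_norm_adherent bB e0; rewrite -/c in xe.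
pose t := nrm (B x).
have h1 : nrm (B (B x) - (c ^+ 2)%:C *: x) ^+ 2 <= c ^+ 2 * (c ^+ 2 - t ^+ 2).
  rewrite (nrmB_sq dot_norm) nrmZC dotZr conj_Creal ?complex_real //.
  rewrite sB dotxx // -/t -rmorphM /= ger0_norm ?sqr_ge0 //.
  have : nrm (B (B x)) ^+ 2 <= (c * t) ^+ 2.
    by rewrite ler_sqr ?nnegrE ?mulr_ge0 ?nrm_ge0 // hB.
  have : nrm x ^+ 2 <= 1 by rewrite expr_le1 // nrm_ge0.
  have : 0 <= c ^+ 4 by rewrite exprn_ge0.
  nra.
have tx : t ^+ 2 <= c ^+ 2 * nrm x ^+ 2.
  by rewrite -exprMn ler_sqr ?nnegrE ?mulr_ge0 ?nrm_ge0 // hB.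
have xK : nrm x ^+ 2 <= K ^+ 2 * (c ^+ 2 * (c ^+ 2 - t ^+ 2)).
  apply: (le_trans _ (ler_wpM2l (sqr_ge0 K) h1)).
  by rewrite -exprMn ler_sqr ?nnegrE ?mulr_ge0 ?nrm_ge0 // -{1}(S1 x) hK.
have tc : c ^+ 2 - t ^+ 2 <= 2 * c * e.
  have : (c - e) ^+ 2 <= t ^+ 2.
    rewrite ler_sqr ?nnegrE ?nrm_ge0 ?(ltW xe) // subr_ge0 -eL.
    by rewrite ler_peMl ?(ltW e0) //; lra.
  have : 0 <= e ^+ 2 by exact: sqr_ge0.
  lra.
have : t ^+ 2 <= K ^+ 2 * c ^+ 4 * (2 * c * e).
  apply: (le_trans tx); apply: (le_trans (ler_wpM2l (sqr_ge0 c) xK)).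
  have -> : c ^+ 2 * (K ^+ 2 * (c ^+ 2 * (c ^+ 2 - t ^+ 2))) =
    K ^+ 2 * c ^+ 4 * (c ^+ 2 - t ^+ 2) by ring.
  by rewrite ler_wpM2l // mulr_ge0 // exprn_ge0.
have : 2 * c * e * L = c ^+ 2 / 2.
  by rewrite expr2 -[X in _ = _ * X / 2]eL; field.
have : 0 < c ^+ 2 by rewrite exprn_gt0.
move: tc; rewrite /L; lra.
Qed.

(* Spectral mapping for p^2 - c^2, with c the norm of p(A). *)
Lemma norm_attained_nonzero (p : {poly R}) A : bounded_op A -> selfadj A ->
  p ^+ 2 - (op_norm (op_poly p A) ^+ 2)%:P != 0 ->
  exists2 t, spectrum A t%:C & `|p.[t]| = op_norm (op_poly p A).
Proof.
move=> bA sA; have lA := bounded_op_lin bA; set c := op_norm _; set q := _ - _ => q0.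
have bp := bounded_op_poly p bA.
have [||z rz sz] := @spectrum_cpoly_root _ _ (map_poly (real_complex R) q) A bA.
- by rewrite map_poly_eq0.
- rewrite -op_polyE.
  have -> : op_poly q A = (fun x => op_poly p A (op_poly p A x) - (c ^+ 2)%:C *: x).
    by apply/funext => x; rewrite op_polyB op_polyC expr2 op_polyM.
  exact: selfadj_norm_in_spectrum (selfadj_poly _ sA).
have zE := spectrum_selfadj_real bA sA sz.
exists (complex.Re z); first by rewrite -zE.
move: rz; rewrite zE fmorph_root /root /q !hornerE subr_eq0 => /eqP h.
have c0 : 0 <= c by exact: op_norm_ge0.
by apply/eqP; rewrite -(eqrXn2 (n := 2)) // -normrX h ger0_norm ?sqr_ge0.
Qed.

(** Taken at p = X, where X^2 - c^2 has degree 2 and so is not the zero polynomial. *)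
Lemma spectrum_selfadj_neq0 A : bounded_op A -> selfadj A ->
  exists t : R, spectrum A t%:C.
Proof.
move=> bA sA; have [|t ht _] := @norm_attained_nonzero 'X A bA sA; last by exists t.
rewrite subr_eq0; apply/eqP => /(congr1 (fun p : {poly R} => size p)).
by rewrite size_polyXn => h; have := size_polyC_leq1 (op_norm (op_poly 'X A) ^+ 2); rewrite -h.
Qed.

(** In the remaining case p^2 is the constant c^2, so |p| = c at any point of the spectrum, which is
    not empty. *)
Lemma op_norm_poly_attained (p : {poly R}) A : bounded_op A -> selfadj A ->
  exists2 t, spectrum A t%:C & `|p.[t]| = op_norm (op_poly p A).
Proof.
move=> bA sA; have [q0|] := eqVneq (p ^+ 2 - (op_norm (op_poly p A) ^+ 2)%:P) 0;
  last exact: norm_attained_nonzero.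
have [t ht] := spectrum_selfadj_neq0 bA sA; exists t => //.
have c0 := op_norm_ge0 (bounded_op_poly p bA).
move/eqP: q0; rewrite subr_eq0 => /eqP/(congr1 (horner^~ t)); rewrite !hornerE => h.
by apply/eqP; rewrite -(eqrXn2 (n := 2)) // -normrX h ger0_norm ?sqr_ge0.
Qed.

Lemma op_poly_le (p : {poly R}) A (e : R) x : bounded_op A -> selfadj A ->
  (forall t, spectrum A t%:C -> `|p.[t]| <= e) -> nrm (op_poly p A x) <= e * nrm x.
Proof.
move=> bA sA h; have [t ht et] := op_norm_poly_attained p bA sA.
rewrite (le_trans (op_normP _ (bounded_op_poly p bA))) // ler_wpM2r ?nrm_ge0 //.
by rewrite -et h.
Qed.

(** For |z| > ||T||, T - z is coercive with constant |z| - ||T||. *)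
Lemma spectrum_le T z : bounded_op T -> spectrum T z -> nrm z <= op_norm T.
Proof.
move=> bT hz; rewrite leNgt; apply/negP => h; apply: hz.
apply: (@coercive_invertible _ _ dot dot_norm _ (nrm z - op_norm T)).
- exact: bounded_op_shift.
- by rewrite subr_gt0.
- move=> x; rewrite dotBl dotZl dotxx // nrmBC.
  apply: le_trans (nrm_sub_ge _ _).
  rewrite nrmM nrmC ger0_norm ?sqr_ge0 // mulrBl lerD2l lerN2.
  rewrite (le_trans (nrm_dot dot_norm _ _)) // expr2 mulrA ler_wpM2r ?nrm_ge0 //.
  exact: op_normP.
Qed.

End SelfAdjoint.

(** * Polynomial approximation of powers *)

Section Bernstein.
Variable R : realType.
Implicit Types (g h : nat -> R) (x : R).

(* bernstein n g at x is the expectation of g(S) for S binomial of parameters n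
   and x; the recursion conditions on one trial, and bernstein_quadratic is the
   formula for the variance. *)
Fixpoint bernstein n g : {poly R} :=
  if n is m.+1 then
    (1 - 'X) * bernstein m g + 'X * bernstein m (fun k => g k.+1)
  else (g 0)%:P.

Lemma bernsteinS n g x : (bernstein n.+1 g).[x] =
  (1 - x) * (bernstein n g).[x] + x * (bernstein n (fun k => g k.+1)).[x].
Proof. by rewrite /= !hornerE. Qed.

Lemma bernstein_le n g h x : 0 <= x <= 1 -> (forall k, g k <= h k) ->
  (bernstein n g).[x] <= (bernstein n h).[x].
Proof.
move=> /andP[x0 x1]; elim: n g h => [|n IH] g h gh; first by rewrite /= !hornerC.
by rewrite !bernsteinS lerD // ler_wpM2l ?subr_ge0 // IH.
Qed.

Lemma bernstein_quadratic n (c K a x : R) :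
  (bernstein n (fun k => c + K * (k%:R + a) ^+ 2)).[x] =
  c + K * ((n%:R * x + a) ^+ 2 + n%:R * x * (1 - x)).
Proof.
elim: n a => [|n IH] a; first by rewrite /= hornerC; ring.
rewrite bernsteinS IH.
(* A first success shifts k by one, which the general offset [a] absorbs. *)
have -> : (fun k => c + K * (k.+1%:R + a) ^+ 2) =
          (fun k => c + K * (k%:R + (1 + a)) ^+ 2).
  by apply/funext => k; rewrite -natr1 addrA.
rewrite IH -natr1; ring.
Qed.

(** The hypothesis bounds the oscillation of [f] by a quadratic, whose Bernstein mean is explicit,
    so no tail estimate arises. It is asked on the whole half-line because [bernstein_le] compares
    the samples [g k] at every k, beyond [M] too. *)
Lemma poly_approx (f : R -> R) (M : R) : 0 < M ->
  (forall e : R, 0 < e -> exists2 K : R, 0 <= K &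
     forall s t : R, 0 <= s -> 0 <= t -> `|f s - f t| <= e + K * (s - t) ^+ 2) ->
  forall e : R, 0 < e -> exists p : {poly R},
    forall t : R, 0 <= t <= M -> `|p.[t] - f t| <= e.
Proof.
move=> M0 hf e e0; have e2 : 0 < e / 2 by rewrite divr_gt0.
have [K K0 hK] := hf _ e2.
have L0 : 0 < K * M ^+ 2 + 1 by rewrite ltr_wpDl // mulr_ge0 // sqr_ge0.
(* The variance contributes K M^2 x (1 - x) / n, at most e/2 for this N since x (1 - x) <= 1. *)
have [N hN] := invSn_le (divr_gt0 e2 L0).
pose n : R := N.+1%:R; have n0 : 0 < n by rewrite ltr0n.
pose g k := f (M * (k%:R / n)).
exists (bernstein N.+1 g \Po (M^-1 *: 'X)) => t /andP[t0 tM].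
rewrite horner_comp hornerZ hornerX; set x := M^-1 * t.
have tE : t = M * x by rewrite /x mulrA mulfV ?mul1r // gt_eqF.
have x0 : 0 <= x by rewrite mulr_ge0 // invr_ge0 ltW.
have x1 : x <= 1 by rewrite /x mulrC ler_pdivrMr // mul1r.
have gk k : `|g k - f t| <= e / 2 + K * M ^+ 2 / n ^+ 2 * (k%:R + - (n * x)) ^+ 2.
  apply: (le_trans (hK _ _ _ t0)); first by rewrite mulr_ge0 ?divr_ge0 ?ler0n ?(ltW M0).
  rewrite lerD2l tE le_eqVlt; apply/orP; left; apply/eqP; field.
  by rewrite gt_eqF.
have bound : K * M ^+ 2 / n ^+ 2 * (n * x * (1 - x)) <= e / 2.
  have -> : K * M ^+ 2 / n ^+ 2 * (n * x * (1 - x)) = K * M ^+ 2 * (x * (1 - x)) / n.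
    by field; rewrite gt_eqF.
  have := hN N (leqnn N); rewrite ler_pdivlMr // mulrC => h.
  apply: le_trans h; rewrite ler_wpM2r ?invr_ge0 ?(ltW n0) //.
  have : 0 <= K * M ^+ 2 by rewrite mulr_ge0 // sqr_ge0.
  nra.
have zero : n * x + - (n * x) = 0 by rewrite subrr.
have x01 : 0 <= x <= 1 by rewrite x0.
rewrite ler_norml; apply/andP; split.
  (* The offset -nx cancels the mean, so that only the variance remains in [bernstein_quadratic]. *)
  have := bernstein_le N.+1 (h := g) x01
    (g := fun k => (f t - e / 2) + - (K * M ^+ 2 / n ^+ 2) * (k%:R + - (n * x)) ^+ 2).
  rewrite bernstein_quadratic -/n zero expr0n /= add0r => low.
  have : forall k, f t - e / 2 + - (K * M ^+ 2 / n ^+ 2) * (k%:R + - (n * x)) ^+ 2 <= g k.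
    move=> k; have := gk k; rewrite ler_norml mulNr => /andP[+ _].
    by move: (_ * (_ + _) ^+ 2) => Q; lra.
  by move=> /low; move: bound; rewrite mulNr; move: (_ * (_ * _ * _)) => Q; lra.
have := bernstein_le N.+1 (g := g) x01
  (h := fun k => (f t + e / 2) + (K * M ^+ 2 / n ^+ 2) * (k%:R + - (n * x)) ^+ 2).
rewrite bernstein_quadratic -/n zero expr0n /= add0r => up.
have : forall k, g k <= f t + e / 2 + K * M ^+ 2 / n ^+ 2 * (k%:R + - (n * x)) ^+ 2.
  move=> k; have := gk k; rewrite ler_norml => /andP[_ +].
  by move: (_ * (_ + _) ^+ 2) => Q; lra.
by move=> /up; move: bound; move: (_ * (_ * _ * _)) => Q; lra.
Qed.

(** For v in [0,1] and s <= 1, v^s >= v; apply this to a/(a+b) and b/(a+b), which add up to 1. *)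
Lemma powR_subadditive (s a b : R) : 0 < s <= 1 -> 0 <= a -> 0 <= b ->
  (a + b) `^ s <= a `^ s + b `^ s.
Proof.
move=> /andP[s0 s1] a0 b0; set c := a + b.
have [c0|cN] := eqVneq c 0; first by rewrite c0 powR0 ?gt_eqF // addr_ge0 ?powR_ge0.
have cp : 0 < c by rewrite lt_def cN addr_ge0.
have key u : 0 <= u -> u <= c -> c `^ s * (u / c) <= u `^ s.
  move=> u0 uc; have [->|uN] := eqVneq u 0; first by rewrite mul0r mulr0 powR_ge0.
  have up : 0 < u by rewrite lt_def uN.
  have {2}-> : u = c * (u / c) by rewrite mulrC divfK.
  rewrite powRM ?divr_ge0 ?(ltW cp) // ler_wpM2l ?powR_ge0 //.
  by rewrite ger1_powR // divr_gt0 //= ler_pdivrMr // mul1r.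
have -> : c `^ s = c `^ s * (a / c) + c `^ s * (b / c).
  by rewrite -mulrDr -mulrDl mulfV // mulr1.
by rewrite lerD // key // /c ?lerDl ?lerDr.
Qed.

Lemma powR_dist_le (s a b : R) : 0 < s <= 1 -> 0 <= a -> 0 <= b ->
  `|a `^ s - b `^ s| <= `|a - b| `^ s.
Proof.
move=> s01; wlog ba : a b / b <= a => [hw a0 b0|a0 b0].
  have [ba|/ltW ab] := leP b a; first exact: hw.
  by rewrite distrC (distrC a) hw.
have s0 : 0 <= s by case/andP: s01 => /ltW.
rewrite !ger0_norm ?subr_ge0 ?ge0_ler_powR ?nnegrE // lerBlDr.
by rewrite -{1}(subrK b a) powR_subadditive // subr_ge0.
Qed.

(** Let u = |a - b| and d = e^(1/s). If u <= d then u^s <= e; otherwise u^s <= 1 + u^2 and 1 <=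
    u^2/d^2, whence K = 1/d^2 + 1. *)
Lemma powR_modulus (s : R) : 0 < s <= 1 -> forall e : R, 0 < e ->
  exists2 K : R, 0 <= K & forall a b : R, 0 <= a -> 0 <= b ->
    `|a `^ s - b `^ s| <= e + K * (a - b) ^+ 2.
Proof.
move=> s01 e e0; have /andP[s0 s1] := s01.
pose d := e `^ s^-1; have d0 : 0 < d by rewrite powR_gt0.
have ds : d `^ s = e by rewrite -powRrM mulVf ?gt_eqF // powRr1 // ltW.
have K0 : 0 <= d ^- 2 + 1 by rewrite addr_ge0 // invr_ge0 sqr_ge0.
exists (d ^- 2 + 1) => // a b a0 b0.
apply: (le_trans (powR_dist_le s01 a0 b0)).
rewrite -[(a - b) ^+ 2]real_normK ?num_real //; set u := `|a - b|.
have u0 : 0 <= u by exact: normr_ge0.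
have [ud|du] := leP u d.
  rewrite -[leLHS]addr0 lerD ?mulr_ge0 ?sqr_ge0 //.
  by rewrite -ds ge0_ler_powR ?nnegrE ?(ltW s0) ?(ltW d0).
have up : 0 < u by exact: lt_trans du.
have h1 : u `^ s <= 1 + u ^+ 2.
  have [u1|/ltW u1] := leP u 1.
    have : u `^ s <= 1 `^ s by rewrite ge0_ler_powR ?nnegrE ?(ltW s0).
    rewrite powR1.
    by move=> h; rewrite (le_trans h) // lerDl sqr_ge0.
  by rewrite (le_trans (ler1_powR u1 s1)) //; nra.
have h2 : 1 <= d ^- 2 * u ^+ 2.
  rewrite mulrC ler_pdivlMr ?exprn_gt0 // mul1r ler_sqr ?nnegrE //; exact: ltW.
by rewrite mulrDl mul1r; move: h1 h2 (ltW e0); lra.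
Qed.

Lemma powR_poly_approx (s M : R) : 0 <= s <= 1 -> 0 < M ->
  forall e : R, 0 < e -> exists p : {poly R},
    forall t : R, 0 <= t <= M -> `|p.[t] - t `^ s| <= e.
Proof.
move=> /andP[s0 s1] M0; have [->|sN] := eqVneq s 0.
  move=> e e0; exists 1 => t _.
  by rewrite powRr0 hornerC subrr normr0 ltW.
by apply: poly_approx => //; apply: powR_modulus; rewrite lt_def sN s0.
Qed.

End Bernstein.

(** * Continuous functional calculus *)

Section FunctionalCalculus.
Variables (R : realType) (H : completeNormedModType R[i]).
Variable dot : {dot H for conjC}.
Hypothesis dot_norm : forall x : H, dot x x = `|x| ^+ 2.
Hypothesis H_neq0 : exists x : H, x != 0.
Implicit Types (x y : H) (A B C T : H -> H) (f g : R -> R).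

(** An equivalent of [is_func_calc] for bounded [A], with one polynomial per tolerance and pointwise
    bounds in place of a sequence and a limit of norms. *)
Definition fcalc f A B := bounded_op B /\
  forall e : R, 0 < e -> exists p : {poly R},
    (forall t : R, spectrum A t%:C -> `|p.[t] - f t| <= e) /\
    forall x, nrm (op_poly p A x - B x) <= e * nrm x.

Lemma is_func_calcP f A B : bounded_op A -> is_func_calc f A B <-> fcalc f A B.
Proof.
move=> bA; split=> -[bB].
  move=> [p [hp hB]]; split=> // e e0.
  have bD n : bounded_op (fun x => op_poly (p n) A x - B x).
    have -> : (fun x => op_poly (p n) A x - B x) = (fun x => op_poly (p n) A x - 1 *: B x).
      by apply/funext => x; rewrite scale1r.
    by apply: bounded_op_subZ => //; exact: bounded_op_poly.
  have [N1 _ h1] := hp e e0.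
  have /cvgrPdist_le/(_ e e0)[N2 _ h2] := hB.
  pose n := maxn N1 N2; exists (p n); split=> [t|x].
    by apply: h1; exact: leq_maxl.
  apply: (le_trans (op_normP x (bD n))); rewrite ler_wpM2r ?nrm_ge0 //.
  have := h2 n (leq_maxr _ _); rewrite /= sub0r normrN.
  by apply: le_trans; exact: ler_norm.
move=> h; split=> //.
have /choice[p hp] : forall n : nat, exists p : {poly R},
    (forall t : R, spectrum A t%:C -> `|p.[t] - f t| <= n.+1%:R^-1) /\
    forall x, nrm (op_poly p A x - B x) <= n.+1%:R^-1 * nrm x.
  by move=> n; apply: h; rewrite invr_gt0.
exists p; split.
  move=> e e0; have [N hN] := invSn_le e0; exists N => // n /= hn t ht.
  by rewrite (le_trans ((hp n).1 t ht)) // hN.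
apply/cvgrPdist_le => e e0; have [N hN] := invSn_le e0; exists N => // n /= hn.
have on : opb (fun x => op_poly (p n) A x - B x) n.+1%:R^-1.
  by split; [rewrite invr_ge0 | exact: (hp n).2].
rewrite sub0r normrN ger0_norm.
  by rewrite (le_trans (op_norm_le on)) // hN.
apply: op_norm_ge0; apply/bounded_opP; split; last by exists n.+1%:R^-1.
move=> a x y; rewrite (bounded_op_lin (bounded_op_poly (p n) bA)) (bounded_op_lin bB).
by rewrite scalerBr opprD addrACA.
Qed.

(** Only the values on the spectrum matter, so identities between powers may be used where t >= 0
    alone. *)
Lemma fcalc_congr f g A B :
  (forall t : R, spectrum A t%:C -> f t = g t) -> fcalc f A B -> fcalc g A B.
Proof.
move=> fg [bB h]; split=> // e /h[p [h1 h2]]; exists p; split=> // t ht.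
by rewrite -fg // h1.
Qed.

Lemma fcalc_poly (p : {poly R}) A : bounded_op A -> fcalc (horner p) A (op_poly p A).
Proof.
move=> bA; split=> [|e e0]; first exact: bounded_op_poly.
exists p; split=> [t _|x]; first by rewrite subrr normr0 ltW.
by rewrite subrr nrm0 mulr_ge0 ?nrm_ge0 ?ltW.
Qed.

Lemma fcalc_id A : bounded_op A -> fcalc id A A.
Proof.
move=> bA; have := fcalc_poly 'X bA.
have -> : op_poly 'X A = A.
  by apply/funext => x; apply: op_polyX; exact: bounded_op_lin.
by apply: fcalc_congr => t _; rewrite hornerX.
Qed.

Section SelfAdjointBase.
Variable A : H -> H.
Hypothesis bA : bounded_op A.
Hypothesis sA : selfadj dot A.

Lemma fcalc_le f B (c : R) x : fcalc f A B ->
  (forall t : R, spectrum A t%:C -> `|f t| <= c) -> nrm (B x) <= c * nrm x.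
Proof.
move=> [bB h] hf; apply: le_add_eps => e e0.
have [|d [d0 dx]] := @small_factor _ e (2 * nrm x) e0.
  by rewrite mulr_ge0 ?nrm_ge0.
have [p [h1 h2]] := h d d0.
have hp : nrm (op_poly p A x) <= (c + d) * nrm x.
  apply: (op_poly_le dot_norm H_neq0 x bA sA) => t ht.
  rewrite -(subrK (f t) p.[t]) (le_trans (ler_normD _ _)) // addrC.
  by rewrite lerD ?hf ?h1.
have := nrm_dist_le 0 (op_poly p A x) (B x); rewrite !sub0r !nrmN.
have := h2 x; lra.
Qed.

Lemma fcalc_unique f B C : fcalc f A B -> fcalc f A C -> B = C.
Proof.
move=> [bB hB] [bC hC]; apply/funext => x; apply/eqP; rewrite -subr_eq0; apply/eqP.
apply: nrm_eps0 => e e0.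
(* The difference p - q is within 2d of 0 on the spectrum, and each approximation of [B x] and [C x]
   costs another d. *)
have [|d [d0 dx]] := @small_factor _ e (4 * nrm x) e0.
  by rewrite mulr_ge0 ?nrm_ge0.
have [p [p1 p2]] := hB d d0; have [q [q1 q2]] := hC d d0.
have : nrm (op_poly (p - q) A x) <= (2 * d) * nrm x.
  apply: (op_poly_le dot_norm H_neq0 x bA sA) => t ht.
  rewrite !hornerE (_ : p.[t] - q.[t] = (p.[t] - f t) - (q.[t] - f t)); last by ring.
  rewrite (le_trans (ler_normB _ _)) //; have := p1 t ht; have := q1 t ht; lra.
rewrite op_polyB => h3.
have := nrm_dist_le (B x) (op_poly p A x) (C x).
have := nrm_dist_le (op_poly p A x) (op_poly q A x) (C x).
rewrite (nrmBC (B x) (op_poly p A x)); have := p2 x; have := q2 x; lra.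
Qed.

(** Polynomials uniformly close on the spectrum give operators close in norm, so the p_n(A)x are
    Cauchy; linearity and boundedness pass to the limit. *)
Lemma fcalc_exists f : (forall e : R, 0 < e -> exists p : {poly R},
    forall t : R, spectrum A t%:C -> `|p.[t] - f t| <= e) ->
  exists B, fcalc f A B.
Proof.
move=> hf.
have /choice[p hp] : forall n : nat, exists p : {poly R},
    forall t : R, spectrum A t%:C -> `|p.[t] - f t| <= n.+1%:R^-1.
  by move=> n; apply: hf; rewrite invr_gt0.
have pp m n x : nrm (op_poly (p m) A x - op_poly (p n) A x) <=
    (m.+1%:R^-1 + n.+1%:R^-1) * nrm x.
  rewrite -op_polyB; apply: (op_poly_le dot_norm H_neq0 x bA sA) => t ht.
  rewrite !hornerE (_ : (p m).[t] - (p n).[t] =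
    ((p m).[t] - f t) - ((p n).[t] - f t)); last by ring.
  by rewrite (le_trans (ler_normB _ _)) // lerD ?hp.
have /choice[B hB] : forall x, exists l, tends (fun n => op_poly (p n) A x) l.
  move=> x; apply: nrm_cauchy_tends => e e0.
  have [|d [d0 dx]] := @small_factor _ e (2 * nrm x) e0.
    by rewrite mulr_ge0 ?nrm_ge0.
  have [N hN] := invSn_le d0; exists N => m n hm hn.
  rewrite (le_trans (pp _ _ _)) //; apply: le_trans dx.
  rewrite mulrA ler_wpM2r ?nrm_ge0 // mulr_natr mulr2n.
  by rewrite lerD ?hN.
have pB n x : nrm (op_poly (p n) A x - B x) <= n.+1%:R^-1 * nrm x.
  apply: le_add_eps => e e0; have e1 : 0 < e / 2 by rewrite divr_gt0.
  have [d [d0 dx]] := small_factor e1 (nrm_ge0 x).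
  have [N1 h1] := hB x _ e1; have [N2 h2] := invSn_le d0.
  pose m := maxn N1 N2.
  have := h1 m (leq_maxl _ _); have := h2 m (leq_maxr _ _).
  have := nrm_dist_le (op_poly (p n) A x) (op_poly (p m) A x) (B x).
  have := pp n m x; rewrite mulrDl => a1 a2 a3 a4.
  have : m.+1%:R^-1 * nrm x <= e / 2 by rewrite (le_trans _ dx) // ler_wpM2r ?nrm_ge0.
  move: a1 a2 a4; move: (_ * nrm x) (_ * nrm x) => i j; lra.
exists B.
have lB : linear B.
  move=> a x y; apply/eqP; rewrite -subr_eq0; apply/eqP/nrm_eps0 => e e0.
  pose K := nrm (a *: x + y) + nrm a * nrm x + nrm y + 1.
  have K0 : 0 < K by rewrite ltr_wpDl // !addr_ge0 ?mulr_ge0 ?nrm_ge0.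
  have [N /(_ N (leqnn N)) hN] := invSn_le (divr_gt0 e0 K0).
  have lp := bounded_op_lin (bounded_op_poly (p N) bA).
  (* Since p_N(A) is linear, the defect of linearity of B is a combination of three approximation
     errors. *)
  have -> : B (a *: x + y) - (a *: B x + B y) =
     a *: (op_poly (p N) A x - B x) + (op_poly (p N) A y - B y)
     - (op_poly (p N) A (a *: x + y) - B (a *: x + y)).
    by rewrite lp scalerBr opprB [X in _ = X + _]addrACA -opprD [RHS]addrC addrA subrK.
  rewrite (le_trans (nrmB _ _)) //.
  have h1 := nrmD (a *: (op_poly (p N) A x - B x)) (op_poly (p N) A y - B y).
  have h2 := pB N x; have h3 := pB N y; have h4 := pB N (a *: x + y).
  rewrite nrmZ in h1; have h5 := ler_wpM2l (nrm_ge0 a) h2.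
  have : N.+1%:R^-1 * K <= e by rewrite -ler_pdivlMr.
  rewrite /K; have i0 : 0 <= N.+1%:R^-1 :> R by rewrite invr_ge0.
  move: (N.+1%:R^-1) i0 h2 h3 h4 h5 h1 => i; lra.
have bB : bounded_op B.
  have /bounded_opP[_ [M [M0 hM]]] := bounded_op_poly (p 0) bA.
  apply/bounded_opP; split=> //; exists (M + 1); split; first by rewrite addr_ge0.
  move=> x; have := pB 0 x; have := hM x.
  have := nrm_dist_le 0 (op_poly (p 0) A x) (B x); rewrite !sub0r !nrmN invr1; lra.
split=> // e e0; have [N /(_ N (leqnn N)) hN] := invSn_le e0.
exists (p N); split=> [t ht|x]; first by rewrite (le_trans (hp _ _ ht)).
by rewrite (le_trans (pB _ _)) // ler_wpM2r ?nrm_ge0.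
Qed.

(** From pq - fg = (p - f)q + f(q - g), on the spectrum and for the operators alike; the bounds [F]
    and [G] control the two cofactors. *)
Lemma fcalc_mul f g B C (F G : R) : fcalc f A B -> fcalc g A C ->
  (forall t : R, spectrum A t%:C -> `|f t| <= F) ->
  (forall t : R, spectrum A t%:C -> `|g t| <= G) ->
  fcalc (fun t => f t * g t) A (B \o C).
Proof.
move=> fB gC hF hG; have [bB hB] := fB; have [bC hC] := gC.
have lA := bounded_op_lin bA.
split=> [|e e0]; first exact: bounded_op_comp.
have [t0 ht0] := spectrum_selfadj_neq0 dot_norm H_neq0 bA sA.
have F0 : 0 <= F by apply: le_trans (hF _ ht0).
have G0 : 0 <= G by apply: le_trans (hG _ ht0).
(* Both errors are at most d(G + d) + Fd, and d <= 1 brings this below d(F + G + 1). *)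
pose d := Num.min 1 (e / (F + G + 1)).
have d0 : 0 < d by rewrite lt_min ltr01 divr_gt0 // ltr_wpDl // addr_ge0.
have d1 : d <= 1 by rewrite ge_min lexx.
have de : d * (F + G + 1) <= e.
  by rewrite -ler_pdivlMr ?ge_min ?lexx ?orbT // ltr_wpDl // addr_ge0.
have dd : d * (G + d) + F * d <= e.
  by apply: le_trans de; nra.
have [p [p1 p2]] := hB _ d0; have [q [q1 q2]] := hC _ d0.
exists (p * q); split=> [t ht|x].
  rewrite hornerM (_ : p.[t] * q.[t] - f t * g t =
     (p.[t] - f t) * q.[t] + f t * (q.[t] - g t)); last by ring.
  apply: le_trans dd; rewrite (le_trans (ler_normD _ _)) // !normrM lerD //.
    rewrite ler_pM ?p1 // -(subrK (g t) q.[t]) addrC (le_trans (ler_normD _ _)) //.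
    by rewrite lerD ?hG ?q1.
  by rewrite ler_pM ?hF ?q1.
rewrite op_polyM // /=.
have lB := bounded_op_lin bB.
have h1 := nrm_dist_le (op_poly p A (op_poly q A x)) (B (op_poly q A x)) (B (C x)).
rewrite (le_trans h1) // -linB //.
have h2 := p2 (op_poly q A x).
have h3 := fcalc_le (op_poly q A x - C x) fB hF.
have h4 : nrm (op_poly q A x) <= (G + d) * nrm x.
  have := nrm_dist_le 0 (C x) (op_poly q A x); rewrite !sub0r !nrmN nrmBC.
  have := q2 x; have := fcalc_le x gC hG; lra.
have h5 := ler_wpM2l (ltW d0) h4.
have h6 := ler_wpM2l F0 (q2 x).
have h7 := ler_wpM2r (nrm_ge0 x) dd.
lra.
Qed.

Lemma fcalc_selfadj f B : fcalc f A B -> selfadj dot B.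
Proof.
move=> [bB h] x y; apply/eqP; rewrite -subr_eq0; apply/eqP/nrm_eps0 => e e0.
have [|d [d0 dx]] := @small_factor _ e (2 * (nrm x * nrm y)) e0.
  by rewrite !mulr_ge0 ?nrm_ge0.
have [p [_ hp]] := h d d0.
have -> : dot (B x) y - dot x (B y) =
    dot x (op_poly p A y - B y) - dot (op_poly p A x - B x) y.
  by rewrite dotBl dotBr (selfadj_poly p sA) opprB [RHS]addrC addrA subrK.
rewrite (le_trans (nrmB _ _)) //.
have h1 := nrm_dot dot_norm x (op_poly p A y - B y).
have h2 := nrm_dot dot_norm (op_poly p A x - B x) y.
have h3 := ler_wpM2l (nrm_ge0 x) (hp y).
have h4 := ler_wpM2r (nrm_ge0 y) (hp x).
lra.
Qed.

End SelfAdjointBase.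

Definition positive_op A := [/\ bounded_op A, selfadj dot A &
  forall x, 0 <= complex.Re (dot (A x) x)].

Lemma spectrum_positive A (t : R) : positive_op A -> spectrum A t%:C ->
  0 <= t <= op_norm A.
Proof.
move=> [bA sA pA] ht; apply/andP; split; last first.
  by rewrite (le_trans (ler_norm _)) // -nrmC (spectrum_le dot_norm).
rewrite leNgt; apply/negP => t0; apply: ht.
apply: (@coercive_invertible _ _ dot dot_norm _ (- t)).
- exact: bounded_op_shift.
- by rewrite oppr_gt0.
- move=> x; rewrite dotBl dotZl (dotxx dot_norm).
  apply: le_trans (Re_le_nrm _); apply: le_trans (ler_norm _).
  by rewrite raddfB /= mul0r subr0 mulNr lerDr.
Qed.

Lemma op_powRP A (s : R) : positive_op A -> 0 <= s <= 1 ->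
  fcalc (fun t => t `^ s) A (op_powR A s).
Proof.
move=> pA s01; have [bA sA _] := pA.
(* Adding 1 keeps the interval of approximation nondegenerate when A = 0. *)
have M0 : 0 < op_norm A + 1 by rewrite ltr_wpDl // op_norm_ge0.
have [|B hB] := @fcalc_exists A bA sA (fun t => t `^ s).
  move=> e /(powR_poly_approx s01 M0)[p hp]; exists p => t ht; apply: hp.
  have /andP[-> h] := spectrum_positive pA ht.
  by rewrite (le_trans h) // lerDl.
apply/(is_func_calcP _ _ bA).
by apply: (@getPex _ (is_func_calc (fun t => t `^ s) A)); exists B; apply/is_func_calcP.
Qed.

Lemma powR_le_spectrum A (s t : R) : positive_op A -> 0 <= s -> spectrum A t%:C ->
  `|t `^ s| <= op_norm A `^ s.
Proof.
move=> pA s0 /(spectrum_positive pA)/andP[t0 tM].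
by rewrite ger0_norm ?powR_ge0 // ge0_ler_powR // nnegrE // (le_trans t0).
Qed.

Lemma op_powR_le A (s : R) x : positive_op A -> 0 <= s <= 1 ->
  nrm (op_powR A s x) <= op_norm A `^ s * nrm x.
Proof.
move=> pA s01; have [bA sA _] := pA.
apply: (fcalc_le bA sA x (op_powRP pA s01)) => t; apply: powR_le_spectrum => //.
by case/andP: s01.
Qed.

(** Multiplicativity of the calculus and uniqueness. Either exponent may be 0, which covers the
    endpoints lambda = 0 and lambda = 1. *)
Lemma op_powRD A (r s : R) : positive_op A -> 0 <= r -> 0 <= s -> 0 < r + s <= 1 ->
  op_powR A r \o op_powR A s = op_powR A (r + s).
Proof.
move=> pA r0 s0 /andP[rs0 rs1]; have [bA sA _] := pA.
have r1 : 0 <= r <= 1 by rewrite r0 (le_trans _ rs1) // lerDl.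
have s1 : 0 <= s <= 1 by rewrite s0 (le_trans _ rs1) // lerDr.
have t1 : 0 <= r + s <= 1 by rewrite rs1 (ltW rs0).
apply: (fcalc_unique bA sA _ (op_powRP pA t1)).
have := fcalc_mul bA sA (op_powRP pA r1) (op_powRP pA s1)
  (fun t => powR_le_spectrum pA r0 (t := t)) (fun t => powR_le_spectrum pA s0 (t := t)).
by apply: fcalc_congr => t ht; rewrite powRD // gt_eqF.
Qed.

Lemma op_powR1 A : positive_op A -> op_powR A 1 = A.
Proof.
move=> pA; have [bA sA _] := pA.
have i01 : 0 <= (1 : R) <= 1 by rewrite ler01 lexx.
apply: (fcalc_unique bA sA (op_powRP pA i01)).
apply: fcalc_congr (fcalc_id bA) => t /(spectrum_positive pA)/andP[t0 _].
by rewrite powRr1.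
Qed.

Lemma bounded_op_powR A (s : R) : positive_op A -> 0 <= s <= 1 -> bounded_op (op_powR A s).
Proof. by move=> pA s01; have [] := op_powRP pA s01. Qed.

(* The square root of A is the square of the self-adjoint fourth root of A. *)
Lemma op_powR_half_positive A : positive_op A -> positive_op (op_powR A 2^-1).
Proof.
move=> pA; have [bA sA _] := pA.
have h2 : 0 <= (2^-1 : R) <= 1 by lra.
have h4 : 0 <= (4^-1 : R) <= 1 by lra.
have sq : op_powR A 4^-1 \o op_powR A 4^-1 = op_powR A 2^-1.
  have q0 : 0 <= 4^-1 :> R by lra.
  have q1 : 0 < (4^-1 + 4^-1 : R) <= 1 by lra.
  by rewrite op_powRD //; congr op_powR; field.
split; first exact: bounded_op_powR.
  exact: fcalc_selfadj (op_powRP pA h2).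
move=> x; rewrite -sq /= (fcalc_selfadj sA (op_powRP pA h4)) (dotxx dot_norm).
exact: sqr_ge0.
Qed.

End FunctionalCalculus.

(** * Polar decomposition and the Aluthge transform *)

Section SpectrumOfProducts.
Variables (R : realType) (H : completeNormedModType R[i]).
Implicit Types (x y : H) (A B T : H -> H) (mu : R[i]).

(* If S inverts AB - mu, then (BSA - 1) / mu inverts BA - mu. *)
Lemma spectrum_comp_swap A B mu : bounded_op A -> bounded_op B -> mu != 0 ->
  spectrum (A \o B) mu -> spectrum (B \o A) mu.
Proof.
move=> bA bB mu0 + [S' [bS S1 S2]]; apply.
have lA := bounded_op_lin bA; have lB := bounded_op_lin bB; have lS := bounded_op_lin bS.
exists (fun x => mu^-1 *: (A (S' (B x)) - x)); split.
- apply: bounded_op_scale; have -> : (fun x => A (S' (B x)) - x) =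
    (fun x => (A \o (S' \o B)) x - 1 *: x) by apply/funext => x; rewrite scale1r.
  by apply: bounded_op_shift; do 2!apply: bounded_op_comp => //.
- move=> x /=; rewrite (linB _ _ lB) (linZ _ _ lB).
  have /= -> := S1 (B x).
  by rewrite opprB addrC subrK scalerA mulVf // scale1r.
- move=> x /=; rewrite (linZ _ _ lB) (linB _ _ lB).
  have h : B (A (S' (B x))) = B x + mu *: S' (B x).
    by rewrite -{2}(S2 (B x)) /= subrK.
  rewrite h [B x + _]addrC addrK scalerA mulVf // scale1r.
  by rewrite scalerA mulfV // scale1r opprB addrC subrK.
Qed.

(** Writing p - p(mu) = q (X - mu), an inverse S of p(T) - p(mu) gives T - mu the left inverse S
    q(T) and the right inverse q(T) S. *)
Lemma spectrum_cpoly (p : {poly R[i]}) T mu : bounded_op T ->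
  spectrum T mu -> spectrum (cpoly p T) p.[mu].
Proof.
move=> bT + [S [bS S1 S2]]; apply; have lT := bounded_op_lin bT.
have /factor_theorem[q hq] : root (p - p.[mu]%:P) mu by rewrite /root !hornerE subrr.
have lS := bounded_op_lin bS.
have hX x : cpoly ('X - mu%:P) T x = T x - mu *: x.
  by rewrite -polyCN cpolyD cpolyX // cpolyC scaleNr.
have hp x : cpoly p T x - p.[mu] *: x = cpoly (p - p.[mu]%:P) T x.
  by rewrite -polyCN cpolyD cpolyC scaleNr.
have h1 x : cpoly p T x - p.[mu] *: x = cpoly q T (T x - mu *: x).
  by rewrite hp hq cpolyM // hX.
have h2 x : cpoly p T x - p.[mu] *: x = T (cpoly q T x) - mu *: cpoly q T x.
  by rewrite hp hq mulrC cpolyM // hX.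
have left x : S (cpoly q T (T x - mu *: x)) = x by rewrite -h1 S1.
have right x : T (cpoly q T (S x)) - mu *: cpoly q T (S x) = x by rewrite -h2 S2.
(* A left and a right inverse coincide. *)
have comm x : S (cpoly q T x) = cpoly q T (S x) by rewrite -{1}(right x) left.
exists (fun x => S (cpoly q T x)); split=> [|x|x]; last by rewrite comm right.
- apply: (bounded_op_comp bS); exact: bounded_op_cpoly.
- exact: left.
Qed.

Lemma cpolyXn n T : linear T -> cpoly 'X^n T = iter n T.
Proof.
move=> lT; apply/funext => x; elim: n => [|n IH]; first by rewrite cpolyC scale1r.
by rewrite exprSr cpolyMX // IH.
Qed.

Lemma spectrum_iter n T mu : bounded_op T -> spectrum T mu -> spectrum (iter n T) (mu ^+ n).
Proof.
move=> bT /(spectrum_cpoly (p := 'X^n) bT); rewrite cpolyXn ?hornerXn //.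
exact: bounded_op_lin.
Qed.

End SpectrumOfProducts.

(** * Existence of the polar decomposition *)

Section PolarDecomposition.
Variables (R : realType) (H : completeNormedModType R[i]).
Variable dot : {dot H for conjC}.
Hypothesis dot_norm : forall x : H, dot x x = `|x| ^+ 2.
Implicit Types (x y z v w : H) (A B T U : H -> H).

Lemma orthogonal_nrmD_sq x y : dot x y = 0 -> nrm (x + y) ^+ 2 = nrm x ^+ 2 + nrm y ^+ 2.
Proof. by move=> h; rewrite (nrmD_sq dot_norm) h mulr0 addr0. Qed.

(** Split x along the closure of ker U: U kills that part by continuity, and is isometric on the
    orthogonal rest, which is no longer than x. *)
Lemma partial_isometry_le U x : partial_isometry dot U -> nrm (U x) <= nrm x.
Proof.
move=> [bU hU]; have lU := bounded_op_lin bU.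
have sP : lin_subspace (fun x => U x = 0).
  by split=> [|a y z hy hz]; [exact: lin0 | rewrite lU hy hz scaler0 addr0].
have [x0 [h1 h2]] := projection dot_norm x sP.
have Ux0 : U x0 = 0.
  have /bounded_opP[_ [M [M0 hM]]] := bU.
  apply: nrm_eps0 => e e0; have [d [d0 dM]] := small_factor e0 M0.
  have [v [Uv hv]] := h1 d d0.
  have -> : U x0 = U (x0 - v) by rewrite linB // Uv subr0.
  by rewrite (le_trans (hM _)) // mulrC (le_trans _ dM) // ler_wpM2r.
have -> : U x = U (x - x0) by rewrite linB // Ux0 subr0.
have -> : nrm (U (x - x0)) = nrm (x - x0).
  by rewrite /nrm hU // => y; exact: h2.
rewrite -ler_sqr ?nnegrE ?nrm_ge0 //.
have := @orthogonal_nrmD_sq (x - x0) x0; rewrite subrK => -> //; last exact: h2.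
by rewrite lerDl sqr_ge0.
Qed.

Section Construction.
Variables T B : H -> H.
Hypothesis bT : bounded_op T.
Hypothesis bB : bounded_op B.
Hypothesis sB : selfadj dot B.
Hypothesis TB : forall x, nrm (B x) = nrm (T x).

Let lT := bounded_op_lin bT.
Let lB := bounded_op_lin bB.

(* The graph of U: the map By + z |-> Ty, for z in ker T, extended by continuity. *)
Let graph x v := forall e : R, 0 < e -> exists y z,
  [/\ T z = 0, nrm (x - (B y + z)) <= e & nrm (v - T y) <= e].

Let ker_B z : T z = 0 -> B z = 0.
Proof. by move=> h; apply: nrm_le0; rewrite TB h nrm0. Qed.

Let dot_B_ker y z : T z = 0 -> dot (B y) z = 0.
Proof. by move=> h; rewrite sB ker_B // dot0r. Qed.

(** By and z are orthogonal, so |By + z|^2 = |Ty|^2 + |z|^2. This makes By + z |-> Ty well defined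
    and contractive. *)
Let nrm_T_le y z : T z = 0 -> nrm (T y) <= nrm (B y + z).
Proof.
move=> h; rewrite -ler_sqr ?nnegrE ?nrm_ge0 // orthogonal_nrmD_sq ?dot_B_ker //.
by rewrite TB lerDl sqr_ge0.
Qed.

(** A vector w orthogonal to ran B has Bw = 0, hence Tw = 0; being also orthogonal to ker T, it is
    orthogonal to itself. *)
Let dense_sum x (e : R) : 0 < e -> exists y z, T z = 0 /\ nrm (x - (B y + z)) <= e.
Proof.
move=> e0; pose P v := exists y z, T z = 0 /\ v = B y + z.
have sP : lin_subspace P.
  split; first by exists 0, 0; rewrite (lin0 lT) (lin0 lB) addr0.
  move=> a _ _ [y [z [Tz ->]]] [y' [z' [Tz' ->]]].
  exists (a *: y + y'), (a *: z + z'); split; first by rewrite lT Tz Tz' scaler0 addr0.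
  by rewrite lB scalerDr addrACA.
have [w hw|_ [[y [z [Tz ->]]] h]] := dense_of_orthogonal dot_norm sP _ x e0; last first.
  by exists y, z.
have Bw : B w = 0.
  apply: (dot_ext dot_norm) => y; rewrite dot0r -sB dotC (hw (B y)) ?conjC0 //.
  by exists y, 0; rewrite (lin0 lT) addr0.
have Tw : T w = 0 by apply: nrm_le0; rewrite -TB Bw nrm0.
apply: (dot_ext dot_norm) => y; rewrite dot0r.
have ww : dot w w = 0 by apply: hw; exists 0, w; rewrite (lin0 lB) add0r.
suff -> : w = 0 by rewrite dot0r.
apply/eqP; rewrite -nrm_eq0 -(sqrf_eq0 (nrm _)).
by rewrite -(inj_eq (@complexI R)) -(dotxx dot_norm) ww.
Qed.

Let graph_exists x : exists v, graph x v.
Proof.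
have /choice[u hu] : forall n : nat, exists yz : H * H,
    T yz.2 = 0 /\ nrm (x - (B yz.1 + yz.2)) <= n.+1%:R^-1.
  move=> n; have [|y [z h]] := @dense_sum x n.+1%:R^-1; first by rewrite invr_gt0.
  by exists (y, z).
have [|v hv] := @nrm_cauchy_tends _ _ (fun n => T (u n).1).
  move=> e e0; have [N hN] := @invSn_le _ (e / 2) ltac:(by rewrite divr_gt0).
  exists N => m n hm hn; have [m1 m2] := hu m; have [n1 n2] := hu n.
  rewrite -(linB _ _ lT) (le_trans (@nrm_T_le _ ((u m).2 - (u n).2) _)) //.
    by rewrite (linB _ _ lT) m1 n1 subrr.
  rewrite (linB _ _ lB) addrACA -opprD.
  rewrite (le_trans (nrm_dist_le _ x _)) // nrmBC.
  have := le_trans m2 (hN _ hm); have := le_trans n2 (hN _ hn).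
  lra.
exists v => e e0; have [N1 h1] := hv _ e0; have [N2 h2] := invSn_le e0.
pose n := maxn N1 N2; exists (u n).1, (u n).2; split; first exact: (hu n).1.
  by rewrite (le_trans (hu n).2) // h2 // leq_maxr.
by rewrite nrmBC h1 // leq_maxl.
Qed.

Let graph_linear a x y v w : graph x v -> graph y w -> graph (a *: x + y) (a *: v + w).
Proof.
move=> hx hy e e0.
have [|d [d0 de]] := @small_factor _ e (nrm a + 1) e0; first by rewrite addr_ge0 ?nrm_ge0.
have [x1 [x2 [tx bx vx]]] := hx d d0; have [y1 [y2 [ty dy vy]]] := hy d d0.
have na := nrm_ge0 a.
exists (a *: x1 + y1), (a *: x2 + y2); split.
- by rewrite lT tx ty scaler0 addr0.
- have -> : a *: x + y - (B (a *: x1 + y1) + (a *: x2 + y2)) =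
     a *: (x - (B x1 + x2)) + (y - (B y1 + y2)).
    by rewrite lB addrACA -scalerDr opprD addrACA -scalerBr.
  rewrite (le_trans (nrmD _ _)) // nrmZ; have := ler_wpM2l na bx; lra.
- have -> : a *: v + w - T (a *: x1 + y1) = a *: (v - T x1) + (w - T y1).
    by rewrite lT opprD addrACA -scalerBr.
  rewrite (le_trans (nrmD _ _)) // nrmZ; have := ler_wpM2l na vx; lra.
Qed.

Let graph_le x v : graph x v -> nrm v <= nrm x.
Proof.
move=> h; apply: le_add_eps => e e0.
have [y [z [Tz h1 h2]]] := h (e / 2) ltac:(by rewrite divr_gt0).
have := nrm_T_le y Tz.
have := nrm_sub_ge v (T y); have := nrm_sub_ge (B y + z) x.
rewrite nrmBC; lra.
Qed.

Let graph_unique x v w : graph x v -> graph x w -> v = w.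
Proof.
move=> hv hw; apply/eqP; rewrite -subr_eq0; apply/eqP/nrm_le0.
have := graph_le (graph_linear (-1) hw hv).
by rewrite !scaleN1r addNr nrm0 addrC.
Qed.

(** Values on the graph are unique, so linearity and T = UB follow by exhibiting approximants: y =
    x, z = 0 for the point Bx, and y = 0, z = x for x in ker T. *)
Lemma polar_construction : exists U,
  [/\ partial_isometry dot U, ker U = ker T & T = U \o B].
Proof.
have [U hU] := choice graph_exists.
have lU : linear U.
  by move=> a x y; apply: (graph_unique (hU _)); exact: graph_linear.
have kUT : ker U = ker T.
  apply/seteqP; split=> x /= hx.
    have /bounded_opP[_ [M [M0 hM]]] := bT.
    apply: nrm_eps0 => e e0.
    have [|d [d0 de]] := @small_factor _ e (2 * M) e0; first by rewrite mulr_ge0.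
    have [y [z [Tz h1 h2]]] := hU x d d0.
    rewrite hx sub0r nrmN -TB in h2.
    have h3 : nrm (x - z) <= 2 * d.
      have -> : x - z = x - (B y + z) + B y by rewrite opprD addrA addrAC subrK.
      rewrite (le_trans (nrmD _ _)) //; lra.
    have -> : T x = T (x - z) by rewrite (linB _ _ lT) Tz subr0.
    by have := hM (x - z); have := ler_wpM2l M0 h3; lra.
  apply: (graph_unique (hU x)) => e e0; exists 0, x; split=> //.
    by rewrite (lin0 lB) add0r subrr nrm0 ltW.
  by rewrite (lin0 lT) subrr nrm0 ltW.
exists U; split=> //; last first.
  apply/funext => x /=; apply: (graph_unique _ (hU _)) => e e0.
  exists x, 0; rewrite (lin0 lT) addr0 !subrr nrm0; split=> //; exact: ltW.
split.
  apply/bounded_opP; split=> //; exists 1; split=> // x.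
  by rewrite mul1r; exact: graph_le.
move=> x hx; rewrite !nrmE; congr (_%:C); apply/eqP; rewrite eq_le graph_le //=.
apply: le_add_eps => e e0.
have [y [z [Tz h1 h2]]] := hU x (e / 3) ltac:(by rewrite divr_gt0).
have xz : dot x z = 0 by apply: hx; rewrite kUT.
(* Both x and By are orthogonal to z, so <x - (By + z), z> = -|z|^2. *)
have nz : nrm z <= e / 3.
  apply: le_trans h1.
  have [->|z0] := eqVneq z 0; first by rewrite nrm0 nrm_ge0.
  have zp : 0 < nrm z by rewrite lt_def nrm_ge0 nrm_eq0 z0.
  rewrite -(ler_pM2r zp) -expr2.
  have := nrm_dot dot_norm (x - (B y + z)) z.
  by rewrite dotBl dotDl xz dot_B_ker // !add0r nrmN (dotxx dot_norm) nrmC ger0_norm ?sqr_ge0.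
have := nrm_sub_ge x (B y + z); have := nrmD (B y) z.
have := nrm_sub_ge (T y) (U x); rewrite TB (nrmBC (T y)); lra.
Qed.

End Construction.

End PolarDecomposition.

(** * Norm and nonzero spectrum under the Aluthge transform *)

Section Aluthge.
Variables (R : realType) (H : completeNormedModType R[i]).
Variable dot : {dot H for conjC}.
Hypothesis dot_norm : forall x : H, dot x x = `|x| ^+ 2.
Hypothesis H_neq0 : exists x : H, x != 0.
Variable lambda : R.
Hypothesis lambda01 : 0 <= lambda <= 1.
Variable T : H -> H.
Hypothesis bT : bounded_op T.

Lemma adjoint_comp_positive : positive_op dot (adjoint dot T \o T).
Proof.
have [bS hS] := adjointP dot_norm bT; split.
- exact: bounded_op_comp.
- by move=> x y /=; rewrite dotC -hS -dotC hS.
- by move=> x /=; rewrite Re_dotC -hS (dotxx dot_norm) sqr_ge0.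
Qed.

Lemma op_abs_positive : positive_op dot (op_abs dot T).
Proof. exact: (op_powR_half_positive dot_norm H_neq0 adjoint_comp_positive). Qed.

(** The square of |T| is the adjoint of T composed with T, so both squared norms equal the value of
    this form at x. *)
Lemma nrm_op_abs x : nrm (op_abs dot T x) = nrm (T x).
Proof.
have [_ sB _] := op_abs_positive.
have h0 : 0 <= 2^-1 :> R by lra.
have h1 : 0 < (2^-1 + 2^-1 : R) <= 1 by lra.
have pA := adjoint_comp_positive.
have sq : op_abs dot T \o op_abs dot T = adjoint dot T \o T.
  rewrite /op_abs (op_powRD dot_norm H_neq0 pA h0 h0 h1).
  have -> : 2^-1 + 2^-1 = 1 :> R by field.
  exact: (op_powR1 dot_norm H_neq0).
apply/eqP; rewrite -(eqrXn2 (n := 2)) ?nrm_ge0 // -(inj_eq (@complexI R)).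
rewrite -!(dotxx dot_norm) -sB.
have -> : op_abs dot T (op_abs dot T x) = adjoint dot T (T x).
  by have /(congr1 (fun f => f x)) := sq.
by rewrite dotC -(adjointP dot_norm bT).2 -dotC.
Qed.

Lemma op_norm_abs_le : op_norm (op_abs dot T) <= op_norm T.
Proof.
apply: op_norm_le; split=> [|x]; first exact: op_norm_ge0.
by rewrite nrm_op_abs op_normP.
Qed.

Lemma polarP : [/\ partial_isometry dot (polar dot T), ker (polar dot T) = ker T &
  T = polar dot T \o op_abs dot T].
Proof.
apply: (@getPex _ [set U | [/\ partial_isometry dot U, ker U = ker T &
  T = U \o op_abs dot T]]).
have [bB sB _] := op_abs_positive.
exact: (polar_construction dot_norm bT bB sB nrm_op_abs).
Qed.

Let lambda1 : 0 <= 1 - lambda <= 1.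
Proof. by move: lambda01; lra. Qed.

Lemma bounded_aluthge : bounded_op (aluthge dot lambda T).
Proof.
have [[bU _] _ _] := polarP.
have bl := bounded_op_powR dot_norm H_neq0 op_abs_positive lambda01.
have bl1 := bounded_op_powR dot_norm H_neq0 op_abs_positive lambda1.
exact: (bounded_op_comp (bounded_op_comp bl bU) bl1).
Qed.

Lemma op_norm_aluthge_le : op_norm (aluthge dot lambda T) <= op_norm T.
Proof.
apply: le_trans op_norm_abs_le.
have [bB _ _] := op_abs_positive; have c0 := op_norm_ge0 bB.
apply: op_norm_le; split=> // x; rewrite /aluthge /=.
have [pU _ _] := polarP.
apply: (le_trans (op_powR_le dot_norm H_neq0 _ op_abs_positive lambda01)).
set c := op_norm _ in c0 *.
have -> : c * nrm x = c `^ lambda * (c `^ (1 - lambda) * nrm x).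
  rewrite mulrA -powRD; last by rewrite addrC subrK oner_eq0.
  by rewrite addrC subrK powRr1.
rewrite ler_wpM2l ?powR_ge0 // (le_trans (partial_isometry_le dot_norm _ pU)) //.
exact: (op_powR_le dot_norm H_neq0 _ op_abs_positive).
Qed.

(** Moving the left factor |T|^lambda to the right end turns the transform into U|T|^(1 -
    lambda)|T|^lambda = U|T| = T. *)
Lemma spectrum_aluthge mu : mu != 0 -> spectrum T mu -> spectrum (aluthge dot lambda T) mu.
Proof.
move=> mu0; have [[bU _] _ TE] := polarP; have pB := op_abs_positive.
have bl := bounded_op_powR dot_norm H_neq0 pB lambda01.
have bl1 := bounded_op_powR dot_norm H_neq0 pB lambda1.
have -> : aluthge dot lambda T = op_powR (op_abs dot T) lambda \o
   (polar dot T \o op_powR (op_abs dot T) (1 - lambda)) by [].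
move=> h; apply: spectrum_comp_swap => //; first exact: bounded_op_comp.
suff -> : (polar dot T \o op_powR (op_abs dot T) (1 - lambda)) \o
  op_powR (op_abs dot T) lambda = T by [].
have s01 : 0 < 1 - lambda + lambda <= 1 by rewrite subrK ltr01 lexx.
have [/andP[l1 _] /andP[l0 _]] := (lambda1, lambda01).
have pD : op_powR (op_abs dot T) (1 - lambda) \o op_powR (op_abs dot T) lambda = op_abs dot T.
  by rewrite (op_powRD dot_norm H_neq0 pB l1 l0 s01) subrK (op_powR1 dot_norm H_neq0 pB).
by rewrite -compA pD; exact: esym TE.
Qed.

End Aluthge.

(** * Gelfand's formula *)

(** Compactness of a square containing the disc. Local bounds are therefore asked at every centre,
    outside the disc as well. *)
Lemma disc_uniform_bound (R : realType) (P : R -> R[i] -> Prop) :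
  (forall C C' a, C <= C' -> P C a -> P C' a) ->
  (forall a0, exists d : R, 0 < d /\
     exists C, forall a, nrm (a - a0) <= d -> P C a) ->
  forall rho : R, exists C, forall a, nrm a <= rho -> P C a.
Proof.
move=> mono loc rho.
pose K : set (R * R) := `[- rho, rho]%classic `*` `[- rho, rho]%classic.
have cK : compact K by apply: compact_setX; exact: segment_compact.
have := proj1 (compact_near_coveringP K) cK R (pinfty_nbhs R)
  (fun C ab => P C (ab.1 +i* ab.2)) _.
case=> [[x y] _|C [_ hC]].
  have [d [d0 [C hC]]] := loc (x +i* y).
  have d2 : 0 < d / 2 by rewrite divr_gt0.
  exists ([set ab : R * R | `|x - ab.1| < d / 2 /\ `|y - ab.2| < d / 2], [set C' | C <= C']).
    split=> /=; last exact: nbhs_pinfty_ge (num_real C).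
    exists (ball x (d / 2), ball y (d / 2)); first by split; exact: nbhsx_ballx.
    by move=> [u v] /= [].
  move=> [[u v] C'] /= [[hu hv] CC']; apply: (mono C) => //; apply: hC.
  rewrite (le_trans (nrm_le_ReIm _)) //= distrC (distrC v); lra.
(* Neighbourhoods of +oo contain only the numbers strictly above their threshold. *)
exists (C + 1) => -[u v] huv.
have hu := le_trans (Re_le_nrm (u +i* v)) huv.
have hv := le_trans (Im_le_nrm (u +i* v)) huv.
have CC1 : C < C + 1 by rewrite ltrDl.
apply: (hC _ CC1 (u, v)).
by split; rewrite /= in_itv /= -ler_norml.
Qed.

Lemma primitive_root_exists (R : realType) n : (0 < n)%N ->
  exists z : R[i], n.-primitive_root z.
Proof.
pose p : {poly R[i]} := 'X^n - 1; have [r Dp] := closed_field_poly_normal p.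
move=> n_gt0; rewrite (monicP _) ?monicXnsubC // scale1r in Dp.
have rn1 : all n.-unity_root r by apply/allP=> z; rewrite -root_prod_XsubC -Dp.
have sz_r : (n < (size r).+1)%N by rewrite -(size_prod_XsubC r id) -Dp size_XnsubC.
have [|z] := hasP (has_prim_root n_gt0 rn1 _ sz_r); last by exists z.
by rewrite -separable_prod_XsubC -Dp separable_Xn_sub_1 // pnatr_eq0 -lt0n.
Qed.

(** For 0 < k < n the factor w^k - 1 is nonzero, and multiplying by it telescopes the sum to w^(kn)
    - 1 = 0. *)
Lemma sum_primitive_root (F : fieldType) n (w : F) k : n.-primitive_root w ->
  (k < n)%N -> \sum_(j < n) (w ^+ j) ^+ k = if k == 0%N then n%:R else 0.
Proof.
move=> pw kn; case: eqP => [->|/eqP k0].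
  by under eq_bigr do rewrite expr0; rewrite sumr_const card_ord.
have wk : w ^+ k - 1 != 0.
  rewrite subr_eq0 -(prim_order_dvd pw); apply/negP => /dvdn_leq.
  by rewrite lt0n k0 leqNgt kn => /(_ isT).
apply: (mulfI wk); rewrite mulr0.
under eq_bigr do rewrite exprAC.
by rewrite -subrX1 -exprM mulnC exprM (prim_expr_order pw) expr1n subrr.
Qed.

Lemma geometric_small (R : realType) (q e : R) : 0 <= q < 1 -> 0 < e ->
  exists N, forall n, (N <= n)%N -> q ^+ n <= e.
Proof.
move=> /andP[q0 q1] e0.
have /cvgrPdist_le/(_ e e0)[N _ hN] : q ^+ n @[n --> \oo] --> (0 : R).
  by apply: cvg_expr; rewrite ger0_norm.
by exists N => n /hN; rewrite /= sub0r normrN ger0_norm ?exprn_ge0.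
Qed.

Section SpectralRadius.
Variables (R : realType) (H : completeNormedModType R[i]).
Variable dot : {dot H for conjC}.
Hypothesis dot_norm : forall x : H, dot x x = `|x| ^+ 2.
Variable T : H -> H.
Hypothesis bT : bounded_op T.
Implicit Types (x y : H) (a : R[i]).

Lemma le_spectral_radius mu : spectrum T mu -> nrm mu <= spectral_radius T.
Proof.
move=> hmu; apply: ub_le_sup; last by exists mu.
by exists (op_norm T) => r [z hz <-]; exact: (spectrum_le dot_norm).
Qed.

Lemma spectral_radius_ge0 : 0 <= spectral_radius T.
Proof.
have [[mu hmu]|h] := pselect (exists mu, spectrum T mu).
  by apply: le_trans (le_spectral_radius hmu); exact: nrm_ge0.
(* For an empty spectrum, [sup set0] is 0. *)
rewrite /spectral_radius (_ : [set _ | _ in _] = set0) ?sup0 //.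
by apply/seteqP; split=> // r [mu hmu _]; case: h; exists mu.
Qed.

(** For a <> 0 this is -a (T - 1/a): the disc |a| <= 1/s stands for the exterior |mu| >= s, together
    with the point at infinity a = 0. *)
Let D a x := x - a *: T x.

Let lT := bounded_op_lin bT.

Let lin_D a : linear (D a).
Proof. by apply: lin_subZ => //; exact: lin_id. Qed.

Let D_geometric a n y :
  D a (\sum_(k < n) a ^+ k *: iter k T y) = y - a ^+ n *: iter n T y.
Proof.
elim: n => [|n IH].
  by rewrite big_ord0 (lin0 (lin_D a)) expr0 scale1r subrr.
rewrite big_ord_recr /= (linD _ _ (lin_D a)) IH {1}/D (linZ _ _ lT).
by rewrite scalerA -exprS addrA subrK.
Qed.

Section Disc.
Variable rho : R.
Hypothesis hD : forall a, nrm a <= rho -> invertible (D a).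

Lemma resolvent_bound : exists2 C : R, 0 < C &
  forall a, nrm a <= rho -> forall y, nrm y <= C * nrm (D a y).
Proof.
have /bounded_opP[_ [M [M0 hM]]] := bT.
have [|a0|C hC] := @disc_uniform_bound R
  (fun C a => nrm a <= rho -> forall y, nrm y <= C * nrm (D a y)) _ _ rho.
- move=> C C' a CC' h /h hy y; rewrite (le_trans (hy y)) // ler_wpM2r ?nrm_ge0 //.
(* Around a centre outside the disc, half the gap as radius makes the claim vacuous. *)
- have [a0r|a0r] := leP (nrm a0) rho; last first.
    exists ((nrm a0 - rho) / 2); split; first by rewrite divr_gt0 // subr_gt0.
    exists 0 => a ha ar; have := nrm_sub_ge a0 a; rewrite nrmBC => h.
    exfalso; lra.
  have [S [/bounded_opP[_ [C0 [C00 hS]]] S1 _]] := hD a0r.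
  have half0 : 0 < 2^-1 :> R by rewrite invr_gt0.
  (* D a0 and D a differ by (a - a0)T; with d M C0 <= 1/2 this term is absorbed, which doubles the
     constant. *)
  have [d [d0 hd]] := small_factor half0 (mulr_ge0 M0 C00).
  exists d; split=> //; exists (2 * C0) => a ha _ y.
  have Da : D a0 y = D a y + (a - a0) *: T y.
    by rewrite /D scalerBl addrA subrK.
  have h1 : nrm y <= C0 * nrm (D a0 y) by rewrite -{1}(S1 y).
  have h2 : nrm (D a0 y) <= nrm (D a y) + d * (M * nrm y).
    rewrite Da (le_trans (nrmD _ _)) // lerD2l nrmZ.
    by rewrite ler_pM ?nrm_ge0.
  have h3 := ler_wpM2l C00 h2; have h4 := ler_wpM2r (nrm_ge0 y) hd; lra.
- exists (`|C| + 1) => [|a ar y]; first by rewrite ltr_wpDl.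
  rewrite (le_trans (hC a ar ar y)) // ler_wpM2r ?nrm_ge0 //.
  by rewrite (le_trans (ler_norm C)) // lerDl.
Qed.

Variables (C M : R).
Hypothesis C0 : 0 < C.
Hypothesis hC : forall a, nrm a <= rho -> forall y, nrm y <= C * nrm (D a y).
Hypothesis TM : opb T M.

(** The implication sits inside the existential so that [choice] yields a function of every a. *)
Let resolvent_exists a : exists S, nrm a <= rho ->
  [/\ forall x, D a (S x) = x, forall x, S (D a x) = x & linear S].
Proof.
have [/hD[S [bS S1 S2]]|h] := pselect (nrm a <= rho); last by exists id.
by exists S; split=> //; exact: bounded_op_lin.
Qed.

(* Averaging (1 - w^j t T)^-1 over the n-th roots of unity w^j gives (1 - t^n T^n)^-1. *)
Lemma power_resolvent_step (t t' eta : R) n : (0 < n)%N ->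
  0 <= t' -> t' <= t -> t <= rho -> (t - t') * (M * C ^+ 2) <= 8^-1 ->
  eta * C <= 8^-1 ->
  (forall x, t' ^+ n * nrm (iter n T x) <= eta * nrm x) ->
  forall x, t ^+ n * nrm (iter n T x) <= 2^-1 * nrm x.
Proof.
move=> n0 t0' tt' tr hd he hT y.
have t0 : 0 <= t by exact: le_trans tt'.
have [w pw] := primitive_root_exists R n0.
have nw : nrm w = 1.
  apply/eqP; rewrite -(pexpr_eq1 n0) ?nrm_ge0 // -nrmX (prim_expr_order pw).
  by rewrite nrm1.
have [f hf] := choice resolvent_exists.
pose p s j : R[i] := w ^+ j * s%:C.
have np s j : 0 <= s -> nrm (p s j) = s.
  by move=> s0; rewrite nrmM nrmX nw expr1n mul1r nrmC ger0_norm.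
have pn s j : p s j ^+ n = (s ^+ n)%:C.
  by rewrite /p exprMn exprAC (prim_expr_order pw) expr1n mul1r rmorphXn.
have avg s z : 0 <= s -> s <= rho ->
    \sum_(j < n) f (p s j) (z - (s ^+ n)%:C *: iter n T z) = n%:R *: z.
  move=> s0 sr.
  transitivity (\sum_(j < n) \sum_(k < n) (p s j) ^+ k *: iter k T z).
    apply: eq_bigr => j _; rewrite -(pn s j) -D_geometric.
    by have [|_ -> _] := hf (p s j); rewrite ?np.
  rewrite exchange_big /=.
  transitivity (\sum_(k < n) (if k == 0%N :> nat then n%:R else 0 : R[i]) *:
      ((s%:C ^+ k) *: iter k T z)).
    apply: eq_bigr => k _; rewrite -(sum_primitive_root pw (ltn_ord k)) -scaler_suml.
    rewrite scalerA mulr_suml; congr (_ *: _); apply: eq_bigr => j _.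
    by rewrite exprMn.
  rewrite (bigD1 (Ordinal n0)) //= expr0 scale1r big1 ?addr0 // => k.
  by rewrite -val_eqE /= => /negPf ->; rewrite scale0r.
(* At t the averaged resolvents send x to y exactly; at t' they almost fix x, because t'^n T^n is
   small. *)
pose x := y - (t ^+ n)%:C *: iter n T y.
have tr' : t' <= rho by exact: le_trans tr.
have fC s j z : 0 <= s -> s <= rho -> nrm (f (p s j) z) <= C * nrm z.
  move=> s0 sr; have [|h1 _ _] := hf (p s j); rewrite ?np //.
  by rewrite -{2}(h1 z) hC // np.
(* The resolvent identity, whose factor C (t - t') M C is at most 1/8 by hypothesis. *)
have fdist j : nrm (f (p t j) x - f (p t' j) x) <= 8^-1 * nrm x.
  have [|h1 h2 h3] := hf (p t j); first by rewrite np.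
  have [|h1' h2' h3'] := hf (p t' j); first by rewrite np.
  have pt : nrm (p t j) <= rho by rewrite np.
  apply: (le_trans (hC pt _)).
  have -> : D (p t j) (f (p t j) x - f (p t' j) x) = (p t j - p t' j) *: T (f (p t' j) x).
    rewrite (linB _ _ (lin_D _)) h1 -{1}(h1' x) /D scalerBl.
    by rewrite opprB addrC addrA subrK.
  rewrite nrmZ -mulrBr nrmM nrmX nw expr1n mul1r -rmorphB nrmC ger0_norm ?subr_ge0 //.
  apply: (@le_trans _ _ (C * ((t - t') * (M * (C * nrm x))))); last first.
    have := ler_wpM2r (nrm_ge0 x) hd; lra.
  rewrite ler_pM2l // ler_wpM2l ?subr_ge0 // (le_trans (TM.2 _)) //.
  by rewrite ler_wpM2l ?fC //; exact: TM.1.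
have fsmall j : nrm (f (p t' j) ((t' ^+ n)%:C *: iter n T x)) <= 8^-1 * nrm x.
  rewrite (le_trans (fC _ _ _ _ _)) // nrmZC ger0_norm ?exprn_ge0 //.
  have h1 := ler_wpM2l (ltW C0) (hT x); have h2 := ler_wpM2r (nrm_ge0 x) he; lra.
have key : n%:R *: (y - x) = \sum_(j < n)
   ((f (p t j) x - f (p t' j) x) + f (p t' j) ((t' ^+ n)%:C *: iter n T x)).
  rewrite scalerBr -(avg t y) // -(avg t' x) // -/x -sumrB; apply: eq_bigr => j _.
  have [|_ _ l] := hf (p t' j); first by rewrite np.
  by rewrite [in X in _ - X](linB _ _ l) opprB addrA addrAC.
have nn : 0 < n%:R :> R by rewrite ltr0n.
have yx : nrm (y - x) <= 4^-1 * nrm x.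
  rewrite -(ler_pM2l nn); have -> : n%:R * nrm (y - x) = nrm (n%:R *: (y - x)).
    by rewrite nrmZ -(rmorph_nat (real_complex R)) nrmC normr_nat.
  rewrite key (le_trans (nrm_sum _ _ _)) //.
  apply: (@le_trans _ _ (\sum_(j < n) 4^-1 * nrm x)).
    apply: ler_sum => j _; rewrite (le_trans (nrmD _ _)) //.
    have := fdist j; have := fsmall j; lra.
  by rewrite sumr_const card_ord mulr_natl.
have e1 : y - x = (t ^+ n)%:C *: iter n T y by rewrite /x opprB addrCA subrr addr0.
have e2 : nrm (y - x) = t ^+ n * nrm (iter n T y).
  by rewrite e1 nrmZC ger0_norm ?exprn_ge0.
(* From |y - x| <= |x|/4 follows |x| <= 4|y|/3, hence |y - x| <= |y|/3. *)
rewrite -e2; have := nrm_sub_ge x y; rewrite nrmBC; have := nrm_ge0 x; lra.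
Qed.

Let vanish (s : R) := forall eta : R, 0 < eta -> exists N, forall n, (N <= n)%N ->
  forall x, s ^+ n * nrm (iter n T x) <= eta * nrm x.

(** The previous lemma only bounds t^n T^n by 1/2; passing to s < t brings the factor (s/t)^n, which
    tends to 0. *)
Let vanish_step (t t' s : R) : 0 <= t' -> t' <= t -> t <= rho ->
  (t - t') * (M * C ^+ 2) <= 8^-1 -> vanish t' -> 0 <= s -> s < t -> vanish s.
Proof.
move=> t0' tt' tr hd vt' s0 st eta eta0.
have tp : 0 < t by exact: le_lt_trans st.
have e8 : 0 < 8^-1 :> R by rewrite invr_gt0.
have [d [d0 dC]] := small_factor e8 (ltW C0).
have [N1 hN1] := vt' d d0.
have q01 : 0 <= s / t < 1.
  by rewrite divr_ge0 ?(ltW tp) //= ltr_pdivrMr // mul1r.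
have [N2 hN2] := geometric_small q01 eta0.
exists (maxn (maxn N1 N2) 1) => n; rewrite !geq_max => /andP[/andP[n1 n2] n3] x.
have h := power_resolvent_step n3 t0' tt' tr hd dC (hN1 n n1) x.
have -> : s ^+ n = (s / t) ^+ n * t ^+ n by rewrite -exprMn divfK // gt_eqF.
rewrite -mulrA ler_pM ?hN2 ?mulr_ge0 ?exprn_ge0 ?nrm_ge0 ?(ltW tp) //.
  by case/andP: q01.
by rewrite (le_trans h) // ler_piMl ?nrm_ge0 //; lra.
Qed.

(** Induction on the number of half-steps d/2. To reach u, step from u - d/2 to u + d/2, a length d
    allowed by the uniform resolvent bound, so that u lies strictly below the new radius; d <= rho -
    s keeps it in the disc. *)
Lemma vanish_in_disc (s : R) : 0 <= s -> s < rho -> vanish s.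
Proof.
move=> s0 sr; have M0 := TM.1.
have MC : 0 <= M * C ^+ 2 by rewrite mulr_ge0 // exprn_ge0 // ltW.
have e8 : 0 < 8^-1 :> R by rewrite invr_gt0.
have [d' [d0' hd']] := small_factor e8 MC.
pose d := Num.min d' (rho - s).
have d0 : 0 < d by rewrite lt_min d0' subr_gt0.
have dd : d <= d' by rewrite ge_min lexx.
have ds : d <= rho - s by rewrite ge_min lexx orbT.
have main j : forall u, 0 <= u -> u + d / 2 <= rho -> u <= j%:R * (d / 2) -> vanish u.
  elim: j => [|j IH] u u0 ur.
    rewrite mul0r => u0'; have -> : u = 0 by apply/le_anti; rewrite u0 u0'.
    (* The power n = 0 is excluded because 0^0 = 1. *)
    move=> eta eta0; exists 1%N => n n1 x.
    by rewrite expr0n gtn_eqF // mul0r mulr_ge0 ?nrm_ge0 // ltW.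
  rewrite -natr1 mulrDl mul1r => uj.
  pose t' := Num.max 0 (u - d / 2).
  have [tE|tE] : t' = 0 /\ u <= d / 2 \/ t' = u - d / 2 /\ d / 2 <= u.
  - by rewrite /t'; have [h|h] := leP (u - d / 2) 0; [left|right]; split=> //; lra.
  - case: tE => tE ud; apply: (@vanish_step (u + d / 2) t' u) => //.
    + by rewrite tE.
    + by rewrite tE; lra.
    + apply: le_trans hd'; rewrite ler_wpM2r // tE; lra.
    + by apply: IH; rewrite tE ?add0r //; [lra | rewrite mulr_ge0 //; lra].
    + lra.
  - case: tE => tE ud; apply: (@vanish_step (u + d / 2) t' u) => //.
    + by rewrite tE; lra.
    + by rewrite tE; lra.
    + apply: le_trans hd'; rewrite ler_wpM2r // tE; lra.
    + by apply: IH; rewrite tE; lra.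
    + lra.
have d2 : 0 < d / 2 by rewrite divr_gt0.
have := archi_boundP (divr_ge0 s0 (ltW d2)); rewrite ltr_pdivrMr // => hj.
apply: (main _ s s0 _ (ltW hj)); lra.
Qed.

End Disc.

(** The upper half of Gelfand's formula. An intermediate s' leaves 1/s strictly inside the disc |a|
    <= 1/s', where 1 - aT is invertible. *)
Lemma op_norm_iter_eventually (s : R) : spectral_radius T < s ->
  exists N, forall n, (N <= n)%N -> op_norm (iter n T) <= s ^+ n.
Proof.
move=> rs; have r0 := spectral_radius_ge0.
pose s' := (spectral_radius T + s) / 2.
have rs' : spectral_radius T < s' by rewrite /s'; lra.
have ss' : s' < s by rewrite /s'; lra.
have s0' : 0 < s' by lra.
have s0 : 0 < s by lra.
have hD a : nrm a <= s'^-1 -> invertible (D a).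
  move=> ha; have [a0|a0] := eqVneq a 0.
    have -> : D a = id by apply/funext => x; rewrite /D a0 scale0r subr0.
    exact: invertible_id.
  have na : 0 < nrm a by rewrite lt_def nrm_ge0 nrm_eq0 a0.
  have hinv : invertible (fun x => T x - a^-1 *: x).
    apply: contrapT => h; have := @le_spectral_radius a^-1 h.
    have : s' <= (nrm a)^-1 by rewrite -[s']invrK lef_pV2 // posrE invr_gt0.
    by rewrite nrmV; lra.
  have -> : D a = (fun x => (- a) *: (T x - a^-1 *: x)).
    apply/funext => x; rewrite /D scalerBr scaleNr scaleNr scalerA mulfV // scale1r.
    by rewrite opprK addrC.
  apply: invertible_scale => //; last by rewrite oppr_eq0.
  by apply: bounded_op_lin; exact: bounded_op_shift.
have [C C0 hC] := resolvent_bound hD.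
have /bounded_opP[_ [M hM]] := bT.
have i0 : 0 <= s^-1 by rewrite invr_ge0 ltW.
have i1 : s^-1 < s'^-1 by rewrite ltf_pV2 // posrE.
have [N hN] := vanish_in_disc hD C0 hC hM i0 i1 ltr01.
exists N => n /hN h; apply: op_norm_le; split=> [|x]; first by rewrite exprn_ge0 // ltW.
have := h x; rewrite mul1r exprVn mulrC ler_pdivrMr ?exprn_gt0 //.
by rewrite mulrC.
Qed.

End SpectralRadius.

(** * Numerical radius *)

Section NumericalRadius.
Variables (R : realType) (H : completeNormedModType R[i]).
Variable dot : {dot H for conjC}.
Hypothesis dot_norm : forall x : H, dot x x = `|x| ^+ 2.
Hypothesis H_neq0 : exists x : H, x != 0.
Variable S : H -> H.
Hypothesis bS : bounded_op S.
Implicit Types x : H.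

Let values := [set complex.Re `|mu| | mu in numerical_range dot S].

Lemma nrm1P x : (`|x| = 1) <-> (nrm x = 1).
Proof. by rewrite nrmE; split=> [/complexI//|->]. Qed.

Lemma nrm_normalize x : x != 0 -> nrm ((nrm x)^-1%:C *: x) = 1.
Proof.
move=> x0; rewrite nrmZC ger0_norm ?invr_ge0 ?nrm_ge0 // mulVf //.
by rewrite nrm_eq0.
Qed.

Lemma numerical_values_has_sup : has_sup values.
Proof.
split.
  have [x x0] := H_neq0; pose u := (nrm x)^-1%:C *: x.
  exists (nrm (dot (S u) u)), (dot (S u) u) => //; exists u => //=.
  by apply/nrm1P; exact: nrm_normalize.
exists (op_norm S) => r [mu [x /= /nrm1P x1 <-] <-].
rewrite -/(nrm _) (le_trans (nrm_dot dot_norm _ _)) //.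
by have := op_normP x bS; rewrite x1 !mulr1.
Qed.

Lemma nrm_dot_le_numerical_radius x :
  nrm (dot (S x) x) <= numerical_radius dot S * nrm x ^+ 2.
Proof.
have lS := bounded_op_lin bS.
have [->|x0] := eqVneq x 0; first by rewrite dot0r nrm0 nrm0 expr0n /= mulr0.
have nx : nrm x != 0 by rewrite nrm_eq0.
pose u := (nrm x)^-1%:C *: x.
have xE : x = (nrm x)%:C *: u by rewrite /u scalerA -rmorphM mulfV // scale1r.
have -> : nrm (dot (S x) x) = nrm (dot (S u) u) * nrm x ^+ 2.
  rewrite {1 2}xE (linZ _ _ lS) dotZl dotZr nrmM nrmM nrm_conj nrmC.
  by rewrite ger0_norm ?nrm_ge0 //; ring.
rewrite ler_wpM2r ?sqr_ge0 //; apply: ub_le_sup; first exact: numerical_values_has_sup.2.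
by exists (dot (S u) u) => //; exists u => //=; apply/nrm1P; exact: nrm_normalize.
Qed.

Lemma numerical_radius_le_op_norm : numerical_radius dot S <= op_norm S.
Proof.
apply: ge_sup; first exact: numerical_values_has_sup.1.
move=> r [mu [x /= /nrm1P x1 <-] <-].
rewrite -/(nrm _) (le_trans (nrm_dot dot_norm _ _)) //.
by have := op_normP x bS; rewrite x1 !mulr1.
Qed.

Lemma numerical_radius_ge0 : 0 <= numerical_radius dot S.
Proof.
have [x x0] := H_neq0; have := nrm_dot_le_numerical_radius ((nrm x)^-1%:C *: x).
rewrite nrm_normalize // expr1n mulr1; apply: le_trans; exact: nrm_ge0.
Qed.

(** For |mu| > w(S), S - mu is coercive with constant |mu| - w(S). *)
Lemma spectrum_le_numerical_radius mu : spectrum S mu -> nrm mu <= numerical_radius dot S.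
Proof.
move=> hmu; rewrite leNgt; apply/negP => h; apply: hmu.
apply: (@coercive_invertible _ _ dot dot_norm _ (nrm mu - numerical_radius dot S)).
- exact: bounded_op_shift.
- by rewrite subr_gt0.
- move=> x; rewrite dotBl dotZl (dotxx dot_norm) nrmBC.
  apply: le_trans (nrm_sub_ge _ _).
  rewrite nrmM nrmC ger0_norm ?sqr_ge0 // mulrBl lerD2l lerN2.
  exact: nrm_dot_le_numerical_radius.
Qed.

End NumericalRadius.

Section IteratedAluthge.
Variables (R : realType) (H : completeNormedModType R[i]).
Variable dot : {dot H for conjC}.
Hypothesis dot_norm : forall x : H, dot x x = `|x| ^+ 2.
Hypothesis H_neq0 : exists x : H, x != 0.
Variable lambda : R.
Hypothesis lambda01 : 0 <= lambda <= 1.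

(** Proved jointly, since each further transform needs the boundedness of the previous iterate. *)
Lemma iter_aluthgeP n T : bounded_op T ->
  [/\ bounded_op (iter n (aluthge dot lambda) T),
      op_norm (iter n (aluthge dot lambda) T) <= op_norm T &
      forall mu, mu != 0 -> spectrum T mu -> spectrum (iter n (aluthge dot lambda) T) mu].
Proof.
move=> bT; elim: n => [|n [bS nS sS]] //=; split.
- exact: bounded_aluthge.
- exact: le_trans (op_norm_aluthge_le dot_norm H_neq0 lambda01 bS) nS.
- by move=> mu mu0 /(sS mu mu0); exact: spectrum_aluthge.
Qed.

End IteratedAluthge.

Lemma exprK_powR (R : realType) (a : R) k : 0 <= a -> (0 < k)%N ->
  (a ^+ k) `^ k%:R^-1 = a.
Proof.
move=> a0 k0; rewrite -powR_mulrn // -powRrM mulfV ?pnatr_eq0 -?lt0n //.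
by rewrite powRr1.
Qed.

Theorem theorem3p3 (R : realType) (H : completeNormedModType R[i])
    (dot : {dot H for conjC})
    (dot_norm : forall x : H, dot x x = `|x| ^+ 2)
    (H_neq0 : exists x : H, x != 0)
    (lambda : R) (lambda01 : 0 <= lambda <= 1)
    (T : H -> H) (T_bounded : bounded_op T) (n : nat) :
  numerical_radius dot (iter n (aluthge dot lambda) (iter k T)) `^ (k%:R^-1)
    @[k --> \oo] --> spectral_radius T.
Proof.
have lower k : (0 < k)%N -> spectral_radius T <=
    numerical_radius dot (iter n (aluthge dot lambda) (iter k T)) `^ (k%:R^-1).
  move=> k0; set w := numerical_radius _ _.
  (* On an empty set the supremum is 0, below any real power. *)
  have [[mu0 hmu0]|h] := pselect (exists mu, spectrum T mu); last first.
    rewrite /spectral_radius (_ : [set _ | _ in _] = set0) ?sup0 ?powR_ge0 //.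
    by apply/seteqP; split=> // r [mu hmu _]; case: h; exists mu.
  apply: ge_sup; first by exists (nrm mu0), mu0.
  move=> r [mu hmu <-]; rewrite -/(nrm mu).
  have [->|mu_neq0] := eqVneq mu 0; first by rewrite nrm0 powR_ge0.
  have [bS _ sS] := iter_aluthgeP dot_norm H_neq0 lambda01 n (bounded_op_iter k T_bounded).
  have := spectrum_le_numerical_radius dot_norm H_neq0 bS
    (sS _ (expf_neq0 k mu_neq0) (spectrum_iter (n := k) T_bounded hmu)).
  rewrite nrmX => hk; rewrite -[leLHS](exprK_powR (nrm_ge0 mu) k0).
  rewrite ge0_ler_powR ?nnegrE ?invr_ge0 ?exprn_ge0 ?nrm_ge0 //.
  exact: numerical_radius_ge0.
apply/cvgrPdist_le => e e0.
have rs : spectral_radius T < spectral_radius T + e by rewrite ltrDl.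
have [N hN] := op_norm_iter_eventually dot_norm T_bounded rs.
(* At k = 0 the exponent 1/k is 0, and taking k-th roots means nothing. *)
exists (maxn N 1) => // k /=; rewrite geq_max => /andP[Nk k0].
rewrite distrC ger0_norm ?subr_ge0 ?lower // lerBlDl.
have [bS nS _] := iter_aluthgeP dot_norm H_neq0 lambda01 n (bounded_op_iter k T_bounded).
have s0 : 0 <= spectral_radius T + e.
  by rewrite addr_ge0 ?(ltW e0) // (spectral_radius_ge0 dot_norm).
rewrite -[leRHS](exprK_powR s0 k0).
have w0 := numerical_radius_ge0 dot_norm H_neq0 bS.
rewrite ge0_ler_powR ?nnegrE ?invr_ge0 ?exprn_ge0 //.
apply: (le_trans (numerical_radius_le_op_norm dot_norm H_neq0 bS)).
exact: le_trans nS (hN k Nk).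
Qed.
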